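(* Let $r,s\in\mathbb{Z}$ with $2\le r\le N$ and $0\le s\le r-1$. Then the function $$g=\frac{f}{\prod_{i<j}^N(x_i^2-x_j^2)^{\frac1r}\prod_{i=1}^Nx_i^{\frac12-\frac sr}}$$ is locally $L^2$-integrable on $\mathbb{R}^N$ for any $f\in K_{r-1,r-s-1}$, where $K_{r-1,r-s-1}\subset\mathbb{C}[x_1,\dots,x_N]$ is the ideal defined in the context.
   Context: A function $\Psi$ on $\mathbb{R}^N$ is locally $L^2$-integrable if every point has a neighbourhood $U$ with $\int_U|\Psi|^2dx<\infty$. Real powers are understood through absolute values (only $|\Psi|$ matters). Definition of the ideals. Let $\Delta(x_1,\dots,x_p)=\prod_{1\le i<j\le p}(x_i-x_j)$ for $p\ge2$ and $\Delta(x_1)=1$. For a partition $\nu=(\nu_1,\dots,\nu_l)$ of $N$ put $$p_\nu(x)=\Delta(x_1,\dots,x_{\nu_1})\,\Delta(x_{\nu_1+1},\dots,x_{\nu_1+\nu_2})\cdots\Delta(x_{\nu_1+\dots+\nu_{l-1}+1},\dots,x_N).$$ For $1\le k\le N-1$ write $N=kq+t$ with $q,t\in\mathbb{Z}_{\ge0}$, $t<k$, and let $\nu_N^k=((q+1)^t,q^{k-t})$ ($t$ parts equal to $q+1$ followed by $k-t$ parts equal to $q$). For $T\subset\{1,\dots,k\}$ and $\nu=\nu_N^k$ put $$p_{\nu,T}(x)=p_\nu(x_1^2,\dots,x_N^2)\prod_{j\in T}\prod_{i=1}^{\nu_j}x_{\nu_1+\dots+\nu_{j-1}+i}.$$ For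 $0\le u\le k$ let $T_{k,u}=\{k,k-1,\dots,k-u+1\}$ and let $K_{k,u}$ be the ideal of $\mathbb{C}[x_1,\dots,x_N]$ generated by all $\mathrm{S}_N$-images (permutations of variables) of $p_{\nu_N^k,T_{k,u}}$. *)

(* Defs.v *)
From HB Require Import structures.
From mathcomp Require Import all_boot all_order all_algebra all_fingroup.
From mathcomp Require Import mpoly complex.
(* mpoly has to be imported before MathComp-Analysis: in the other order their
   notations do not parse. *)
From mathcomp Require Import all_classical all_reals all_analysis.

Set Implicit Arguments.
Unset Strict Implicit.
Unset Printing Implicit Defensive.

Import Order.TTheory GRing.Theory Num.Theory.
Import numFieldNormedType.Exports.

Local Open Scope classical_set_scope.
Local Open Scope ring_scope.
Local Open Scope complex_scope.

(* R^n is the type 'rV[R]_n, with the sup-norm topology of MathComp-Analysis and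
   the product of the Borel sigma-algebras of the coordinates. *)
Section Lebesgue.
Context {R : realType}.

Definition coord n (i : 'I_n) (x : 'rV[R]_n) : measurableTypeR R := x 0 i.

Lemma rV_set0 n : g_sigma_preimage (@coord n) set0.
Proof. exact: sigma_algebra0. Qed.

Lemma rV_setC n A : g_sigma_preimage (@coord n) A ->
  g_sigma_preimage (@coord n) (~` A).
Proof. exact: sigma_algebraC. Qed.

Lemma rV_bigcup n (F : (set 'rV[R]_n)^nat) :
  (forall i, g_sigma_preimage (@coord n) (F i)) ->
  g_sigma_preimage (@coord n) (\bigcup_i F i).
Proof. exact: sigma_algebra_bigcup. Qed.

HB.instance Definition _ n := @isMeasurable.Build default_measure_display
  'rV[R]_n (g_sigma_preimage (@coord n)) (@rV_set0 n) (@rV_setC n)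
  (@rV_bigcup n).

Lemma measurable_coord n (i : 'I_n) : measurable_fun setT (@coord n i).
Proof.
move=> _ Y mY; rewrite setTI; apply: sub_sigma_algebra => /=.
rewrite -bigcup_seq/=; exists i => /=; first by rewrite mem_index_enum.
by exists Y => //; rewrite setTI.
Qed.

Lemma measurable_fun_coordP d (T : measurableType d) n (f : T -> 'rV[R]_n) :
  (forall i, measurable_fun setT (coord i \o f)) -> measurable_fun setT f.
Proof.
move=> mf; apply: (@measurability _ _ _ _ _ _
  (\big[setU/set0]_(i < n) preimage_set_system setT (@coord n i) measurable)) => //.
move=> _ [A + <-]; rewrite -bigcup_seq => -[i _ [B mB <-]].
by rewrite setTI; exact: mf.
Qed.

Definition rVcons n (p : measurableTypeR R * 'rV[R]_n) : 'rV[R]_n.+1 :=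
  \row_i oapp (p.2 0) p.1 (unlift ord0 i).

Lemma rVcons0 n (p : measurableTypeR R * 'rV[R]_n) : rVcons p 0 ord0 = p.1.
Proof. by rewrite mxE unlift_none. Qed.

Lemma rVconsS n (p : measurableTypeR R * 'rV[R]_n) i :
  rVcons p 0 (lift ord0 i) = p.2 0 i.
Proof. by rewrite mxE liftK. Qed.

Lemma measurable_rVcons n : measurable_fun setT (@rVcons n).
Proof.
apply: measurable_fun_coordP => i; case: (unliftP ord0 i) => [j|] ->.
  have -> : coord (lift ord0 j) \o @rVcons n = @coord n j \o snd.
    by apply/funext => p; rewrite /coord/= rVconsS.
  apply: measurableT_comp => //; exact: measurable_coord.
have -> : coord ord0 \o @rVcons n = fst.
  by apply/funext => p; rewrite /coord/= rVcons0.
exact: measurable_fst.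
Qed.

Definition rVuncons n (x : 'rV[R]_n.+1) : measurableTypeR R * 'rV[R]_n :=
  (x 0 ord0, \row_i x 0 (lift ord0 i)).

Lemma rVconsK n : cancel (@rVcons n) (@rVuncons n).
Proof.
move=> [a v]; rewrite /rVuncons rVcons0; congr (_, _).
by apply/rowP => i; rewrite mxE rVconsS.
Qed.

Lemma measurable_rVuncons n : measurable_fun setT (@rVuncons n).
Proof.
apply/measurable_fun_pairP; split; first exact: (measurable_coord ord0).
apply: measurable_fun_coordP => i.
have -> : coord i \o (snd \o @rVuncons n) = coord (lift ord0 i).
  by apply/funext => x; rewrite /coord/= mxE.
exact: measurable_coord.
Qed.

Section sigma_finite_pushforward.
Variables (n : nat) (mu : {sigma_finite_measure set 'rV[R]_n -> \bar R}).

Definition lebesgue_rVS : set 'rV[R]_n.+1 -> \bar R :=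
  pushforward (@lebesgue_measure R \x mu)%E (@rVcons n).

Lemma rVS0 : lebesgue_rVS set0 = 0%E.
Proof. by rewrite /lebesgue_rVS /pushforward preimage_set0 measure0. Qed.

Lemma rVS_ge0 A : (0 <= lebesgue_rVS A)%E.
Proof. exact: integral_ge0. Qed.

Lemma rVS_sigma_additive : semi_sigma_additive lebesgue_rVS.
Proof.
have mV (B : set 'rV[R]_n.+1) : measurable B -> measurable (@rVcons n @^-1` B).
  by move=> mB; rewrite -[X in measurable X]setTI; exact: measurable_rVcons.
move=> F mF tF mUF; rewrite /lebesgue_rVS /pushforward preimage_bigcup.
apply: measure_semi_sigma_additive.
- by move=> k; exact: mV.
- apply/trivIsetP => /= i j _ _ ij; rewrite -preimage_setI.
  by move/trivIsetP : tF => /(_ _ _ _ _ ij) ->//; rewrite preimage_set0.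
- by rewrite -preimage_bigcup; exact: mV.
Qed.

HB.instance Definition _ := isMeasure.Build _ _ _ lebesgue_rVS
  rVS0 rVS_ge0 rVS_sigma_additive.

Lemma lebesgue_rVS_sigma_finite : sigma_finite setT lebesgue_rVS.
Proof.
have /sigma_finiteP[F [TF ndF Foo]] := sigma_finiteT (@lebesgue_measure R).
have /sigma_finiteP[G [TG ndG Goo]] := sigma_finiteT mu.
exists (fun k => @rVuncons n @^-1` (F k `*` G k)).
  rewrite -preimage_bigcup (_ : \bigcup_k _ = setT) ?preimage_setT//.
  rewrite -subTset => -[a v] _.
  have [k _ Fka] : (\bigcup_k F k) a by rewrite -TF.
  have [l _ Glv] : (\bigcup_k G k) v by rewrite -TG.
  exists (maxn k l) => //; split.
    by move: a Fka; exact/subsetPset/ndF/leq_maxl.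
  by move: v Glv; exact/subsetPset/ndG/leq_maxr.
move=> k; have [mF Fk] := Foo k; have [mG Gk] := Goo k; split.
  by rewrite -[X in measurable X]setTI; apply: measurable_rVuncons => //;
     exact: measurableX.
rewrite /lebesgue_rVS /pushforward -comp_preimage.
rewrite (_ : _ \o _ = id) ?preimage_id; last first.
  by apply/funext => p; exact: rVconsK.
by rewrite product_measure1E// lte_mul_pinfty// ge0_fin_numE.
Qed.

HB.instance Definition _ := Measure_isSigmaFinite.Build _ _ _ lebesgue_rVS
  lebesgue_rVS_sigma_finite.
End sigma_finite_pushforward.

(* Lebesgue measure on R^n, as an iterated product; see lebesgue_rV_box. *)
Fixpoint lebesgue_rV n : {sigma_finite_measure set 'rV[R]_n -> \bar R} :=
  if n is n'.+1 then lebesgue_rVS (lebesgue_rV n') else \d_(0 : 'rV[R]_0).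

Lemma lebesgue_rV_box n (A : 'I_n -> set (measurableTypeR R)) :
  (forall i, measurable (A i)) ->
  lebesgue_rV n [set x | forall i, A i (x 0 i)] =
  (\prod_(i < n) lebesgue_measure (A i))%E.
Proof.
elim: n A => [|n IHn] A mA.
  by rewrite big_ord0 /= diracE mem_set//= => -[].
rewrite big_ord_recl -IHn// /= /lebesgue_rVS /pushforward.
have mB : measurable [set x : 'rV[R]_n | forall i, A (lift ord0 i) (x 0 i)].
  rewrite (_ : mkset _ = \bigcap_(i in setT) (coord i @^-1` A (lift ord0 i))).
    apply: fin_bigcap_measurable; first exact: finite_finset.
    by move=> i _; rewrite -[X in measurable X]setTI; exact: measurable_coord.
  by apply/seteqP; split=> x Ax i; [move=> _|]; exact: Ax.
rewrite -product_measure1E//; congr (_ _).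
apply/seteqP; split=> -[a v] /=.
  move=> Aav; split; first by have := Aav ord0; rewrite rVcons0.
  by move=> i; have := Aav (lift ord0 i); rewrite rVconsS.
move=> [Aa Av] i; case: (unliftP ord0 i) => [j|] ->.
  by rewrite rVconsS; exact: Av.
by rewrite rVcons0.
Qed.

(* The condition on psi also asks that |psi|^2 be measurable on U: the library's
   integral of a nonmeasurable function is only a lower integral. *)
Definition locally_L2 n (psi : 'rV[R]_n -> R[i]) : Prop :=
  forall x : 'rV[R]_n, exists U : set 'rV[R]_n,
    [/\ nbhs x U, measurable U &
        (lebesgue_rV n).-integrable U
          (fun y => (ComplexField.Normc.normc (psi y) ^+ 2)%:E)].
End Lebesgue.

Section Ideals.
Variable A : comNzRingType.
Implicit Types (x : seq A) (nu : seq nat).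

Definition Delta x : A :=
  \prod_(i < size x) \prod_(j < size x | (i < j)%N) (x`_i - x`_j).

Definition p_part nu x : A := \prod_(b <- reshape nu x) Delta b.

(* T is a set of 0-based indices of blocks of nu. *)
Definition p_part_set nu k (T : {set 'I_k}) x : A :=
  p_part nu [seq a ^+ 2 | a <- x] *
  \prod_(j in T) \prod_(a <- nth [::] (reshape nu x) j) a.

Definition generated_ideal (S : set A) : set A :=
  [set f | exists m (c g : 'I_m -> A),
     (forall i, S (g i)) /\ f = \sum_(i < m) c i * g i].
End Ideals.

Definition nu_part (N k : nat) : seq nat :=
  (nseq (N %% k) (N %/ k).+1 ++ nseq (k - N %% k) (N %/ k))%N.

(* The u last of the k indices; 0-based, hence {k - u, ..., k - 1}. *)
Definition T_last (k u : nat) : {set 'I_k} := [set j : 'I_k | (k - u <= j)%N]%SET.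

Definition K_ideal (R : realType) (N k u : nat) : set {mpoly R[i][N]} :=
  generated_ideal
    [set msym s (p_part_set (nu_part N k) (T_last k u) [seq 'X_i | i <- enum 'I_N])
    | s in [set: 'S_N]].
Arguments K_ideal : clear implicits.

(* Main.v *)
(* With y_i = x_i^2 and y_0 = 0, the square of a generator over the square of
   the denominator is |x_1 ... x_N| times a product of powers of the distances
   |y_i - y_j|, 0 <= i < j <= N.  For every set V of at least two indices the
   exponents of the pairs in V sum to more than -(|V| - 1): this only uses that
   the variables are coloured by r - 1 colours, s of them outside T.  By
   single-linkage clustering, the product is then bounded, for some th < 1, by a
   constant times prod_(i > 0) sum_(j < i) |y_i - y_j|^(-th).  On bounded sets
   |x| |x^2 - w^2|^(-th) is dominated by |x - w|^(-th) + |x + w|^(-th), whose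
   integral in x is bounded uniformly in w, so the majorant is integrated one
   variable at a time, starting from the last one. *)

Require Import Defs.
From mathcomp Require Import all_boot all_order all_algebra all_fingroup.
From mathcomp Require Import mpoly complex.
From mathcomp Require Import all_classical all_reals all_analysis.
From mathcomp Require Import measurable_realfun.
From mathcomp Require Import ring lra zify.

Set Implicit Arguments.
Unset Strict Implicit.
Unset Printing Implicit Defensive.

Import Order.TTheory GRing.Theory Num.Theory.
Import numFieldNormedType.Exports.

Local Open Scope ring_scope.
Local Open Scope complex_scope.

(** * Products of powers of distances in a finite metric space *)

(** Up to a constant, |x_1 ... x_N| is the Jacobian of x -> (x_i^2); pulling it out leaves powers of
    distances between y_0 = 0, y_1, ..., y_N only. A pair {i, j} without 0 has exponent 2 - 2/r if
    its colours agree and -2/r otherwise; the pair {0, i} has s/r if the colour of i is in T and s/r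
    - 1 otherwise. The obstacle is that the negative powers cannot be bounded pair by pair: there
    are too many of them, and they must be compensated by the vanishing on pairs of equal colour.
    The condition on V is the natural one: when the points of V collapse to scale D, they occupy a
    volume of order D^(|V| - 1). Which points collapse depends on x, whereas the integration needs
    one fixed majorant. The product of sums over j < i provides it: expanded, it runs over all trees
    rooted at 0 whose labels increase away from the root, and every clustering is bounded by the
    term of such a tree. *)

Lemma big_subset_pairs {T : finType} {R : Type} {idx : R} {op : Monoid.com_law idx}
    (A V : {set T}) (F : T -> T -> R) : A \subset V ->
  \big[op/idx]_(i in V) \big[op/idx]_(j in V) F i j =
  op (op (\big[op/idx]_(i in A) \big[op/idx]_(j in A) F i j)
         (\big[op/idx]_(i in V :\: A) \big[op/idx]_(j in V :\: A) F i j))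
     (op (\big[op/idx]_(i in A) \big[op/idx]_(j in V :\: A) F i j)
         (\big[op/idx]_(i in V :\: A) \big[op/idx]_(j in A) F i j)).
Proof.
move=> AV; have VA (G : T -> R) : \big[op/idx]_(j in V) G j =
    op (\big[op/idx]_(j in A) G j) (\big[op/idx]_(j in V :\: A) G j).
  by rewrite (big_setID A)/= (finset.setIidPr AV).
rewrite VA (eq_bigr _ (fun i _ => VA (F i))) (eq_bigr _ (fun i _ => VA (F i))).
rewrite !big_split/= -!Monoid.mulmA; congr (op _ _).
by rewrite [RHS]Monoid.mulmC -Monoid.mulmA.
Qed.

Lemma path_dist_le {R : realDomainType} {T : eqType} (d : T -> T -> R) (e : rel T)
    (dl : R) x p :
  (forall i, d i i = 0) -> (forall i j k, d i k <= d i j + d j k) ->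
  (forall i j, e i j -> d i j <= dl) -> path e x p ->
  d x (last x p) <= (size p)%:R * dl.
Proof.
move=> d0 dtri edl; elim: p x => [|y p IH] x /=; first by rewrite d0 mul0r.
move=> /andP[exy /IH lep]; apply: le_trans (dtri _ y _) _.
by rewrite -natr1 mulrDl mul1r addrC lerD// edl.
Qed.

Section WeightedMetric.
Context {R : realType} {n : nat}.
(** [w] stands for d^a. The cross pairs of a split at scale D have distances between D / n and D,
    where d^a is at most n^|a| D^a; scaling [w] down by n^|a| beforehand keeps constants out of the
    induction. *)
Variables (d a w : 'I_n -> 'I_n -> R) (th : R).
Hypotheses (dxx : forall i, d i i = 0) (dC : forall i j, d i j = d j i).
Hypothesis dtri : forall i j k, d i k <= d i j + d j k.
Hypothesis d_gt0 : forall i j, i != j -> 0 < d i j.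
Hypotheses (aii : forall i, a i i = 0) (wii : forall i, w i i <= 1).
Hypothesis w_ge0 : forall i j, 0 <= w i j.
Hypothesis w_le : forall i j D, i != j -> 0 < D -> D / n%:R <= d i j <= D ->
  w i j <= D `^ a i j.
Hypothesis th_ge0 : 0 <= th.

(* The power of the scale that is left when the points of V merge, at a price of
   th per merging; every pair is counted twice. *)
Definition excess (V : {set 'I_n}) : R :=
  \sum_(i in V) \sum_(j in V) a i j + th * #|V|.-1%:R.

(** [A] is the component of [m] in the graph joining points of V at distance less than D / n. A
    simple path has fewer than n steps, so it covers a distance less than D and cannot link two
    points that realise the diameter; hence the graph is not connected. *)
Lemma single_linkage_split (V : {set 'I_n}) m D : m \in V ->
    (forall i j, i \in V -> j \in V -> d i j <= D) ->
    (exists i j, [/\ i \in V, j \in V & d i j = D]) -> 0 < D ->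
  exists A : {set 'I_n}, [/\ A \subset V, m \in A, V :\: A != finset.set0 &
    forall i j, i \in A -> j \in V :\: A -> D / n%:R <= d i j].
Proof.
move=> mV leD [i0 [j0 [i0V j0V dD]]] D0.
have n0 : 0 < n%:R :> R by rewrite ltr0n; case: (n) m {mV} => // -[].
pose e := [rel x y | [&& x \in V, y \in V & d x y < D / n%:R]].
have eC : connect_sym e.
  by apply: sym_connect_sym => x y /=; rewrite andbCA (dC x y).
exists [set v in V | connect e m v]; split.
- by apply/fintype.subsetP => v; rewrite inE => /andP[].
- by rewrite inE mV connect0.
- apply/eqP => B0.
  have conn v : v \in V -> connect e m v.
    move=> vV; apply/negPn/negP => nv.
    have : v \in V :\: [set v in V | connect e m v] by rewrite !inE vV/= nv.
    by rewrite B0 inE.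
  have : connect e i0 j0.
    by apply: connect_trans (conn _ j0V); rewrite eC; exact: conn.
  case/connectP => p0 /shortenP[p ep up _] lastp.
  have : d i0 (last i0 p) <= (size p)%:R * (D / n%:R).
    by apply: (path_dist_le dxx dtri _ ep) => i j /= /and3P[_ _ /ltW].
  rewrite -lastp dD leNgt => /negP; apply.
  rewrite mulrCA -[ltRHS]mulr1 ltr_pM2l// ltr_pdivrMr// mul1r ltr_nat.
  by have := max_card (mem (i0 :: p)); rewrite (card_uniqP up) card_ord.
- move=> i j; rewrite !inE => /andP[iV mi] /andP[+ jV].
  rewrite jV/= leNgt; apply: contra => dij.
  by apply: connect_trans mi _; apply: connect1; rewrite /= iV jV.
Qed.

(* Referring each point to those with a smaller label, for an order of the labels
   unrelated to the metric, is what allows integrating the points one by one. *)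
Definition prev_kernel (V : {set 'I_n}) (v : 'I_n) : R :=
  \sum_(u in V | (u < v)%N) d v u `^ (- th).

Lemma prev_kernel_ge0 V v : 0 <= prev_kernel V v.
Proof. by apply: sumr_ge0 => *; exact: powR_ge0. Qed.

Lemma le_prev_kernel (A V : {set 'I_n}) v : A \subset V ->
  prev_kernel A v <= prev_kernel V v.
Proof.
move=> AV; rewrite /prev_kernel big_mkcondr [leRHS]big_mkcondr/=.
rewrite [leRHS](big_setID A)/= (finset.setIidPr AV) lerDl.
by apply: sumr_ge0 => i _; case: ifP => // _; exact: powR_ge0.
Qed.

Lemma cross_weight_le (A B : {set 'I_n}) D : 0 < D -> [disjoint A & B] ->
    (forall i j, i \in A -> j \in B -> D / n%:R <= d i j <= D) ->
  \prod_(i in A) \prod_(j in B) w i j <= D `^ (\sum_(i in A) \sum_(j in B) a i j).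
Proof.
move=> D0 AB dD.
have powR_sum (P : {pred 'I_n}) F : D `^ (\sum_(i in P) F i) = \prod_(i in P) D `^ F i.
  elim/big_rec2 : _ => [|i x y _ <-]; first by rewrite powRr0.
  by rewrite powRD// (gt_eqF D0) implybT.
rewrite powR_sum; apply: ler_prod => i iA; rewrite prodr_ge0//= powR_sum.
apply: ler_prod => j jB; rewrite w_ge0/= w_le// ?dD//.
by apply: contraTneq jB => <-; rewrite (disjointFr AB iA).
Qed.

(* V is split into two clusters at distance comparable to its diameter D1: the
   cross pairs contribute D1 to the power of their exponents, and merging the
   clusters provides the missing factor, that of the least label of B. *)
Theorem weighted_metric_le (V : {set 'I_n}) m D :
    (forall U : {set 'I_n}, U != finset.set0 -> 0 <= excess U) ->
    m \in V -> (forall j, j \in V -> (m <= j)%N) ->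
    (forall i j, i \in V -> j \in V -> d i j <= D) -> 0 < D ->
  \prod_(i in V) \prod_(j in V) w i j <=
  D `^ excess V * \prod_(v in V :\ m) prev_kernel V v.
Proof.
move=> excess_ge0; have [k] := ubnP #|V|.
elim: k => // k IH in V m D *; rewrite ltnS => Vk mV minm leD D0.
have [V1|V1] := eqVneq #|V| 1%N.
  have /finset.cards1P[x Vx] : #|V| == 1%N by rewrite V1.
  move: mV; rewrite Vx !inE => /eqP ->; rewrite !big_set1 finset.setDv big_set0.
  by rewrite /excess !big_set1 aii cards1/= mulr0 addr0 powRr0 mulr1.
have [x xV xm] : exists2 x, x \in V & x != m.
  have : (0 < #|V :\ m|)%N.
    by move: V1; rewrite (cardsD1 m V) mV add1n eqSS lt0n.
  by rewrite card_gt0 => /finset.set0Pn[x]; rewrite !inE => /andP[]; exists x.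
pose dp (p : 'I_n * 'I_n) := d p.1 p.2.
have [[i0 j0]/= /andP[i0V j0V] maxd] : exists2 p : 'I_n * 'I_n,
    (p.1 \in V) && (p.2 \in V) &
    forall q : 'I_n * 'I_n, (q.1 \in V) && (q.2 \in V) -> dp q <= dp p.
  have mm : ((m, m).1 \in V) && ((m, m).2 \in V) by rewrite mV.
  pose P := [pred p : 'I_n * 'I_n | (p.1 \in V) && (p.2 \in V)].
  by case: (@Order.TotalTheory.arg_maxP _ _ _ (m, m) P dp mm) => p pV pmax; exists p.
pose D1 := d i0 j0.
have leD1 i j : i \in V -> j \in V -> d i j <= D1.
  by move=> iV jV; apply: (maxd (i, j)); rewrite /= iV jV.
have D10 : 0 < D1 by apply: lt_le_trans (leD1 _ _ xV mV); exact: d_gt0.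
have [|A [AV mA B0 crossD]] := single_linkage_split mV leD1 _ D10.
  by exists i0, j0.
set B := V :\: A in B0 crossD.
have BV : B \subset V by apply: finset.subsetDl.
have AB : [disjoint A & B].
  by rewrite finset.disjoints_subset; apply/fintype.subsetP => i iA; rewrite !inE iA.
have [m' m'B minm'] : exists2 m', m' \in B & forall j, j \in B -> (m' <= j)%N.
  have /finset.set0Pn[y yB] := B0.
  by case: (@arg_minnP _ y (mem B) val yB) => z zB zmin; exists z.
have mprod (C U : {set 'I_n}) : 0 <= \prod_(i in C) \prod_(j in U) w i j.
  by apply: prodr_ge0 => i _; apply: prodr_ge0.
have cardV : (#|V| = #|A| + #|B|)%N.
  by rewrite -(finset.cardsID A V) (finset.setIidPr AV).
have A_gt0 : (0 < #|A|)%N by rewrite card_gt0; apply/finset.set0Pn; exists m.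
have B_gt0 : (0 < #|B|)%N by rewrite card_gt0.
have ltA : (#|A| < k)%N by apply: leq_trans Vk; rewrite cardV -addn1 leq_add2l.
have ltB : (#|B| < k)%N by apply: leq_trans Vk; rewrite cardV -add1n leq_add2r.
have sA := fintype.subsetP AV; have sB := fintype.subsetP BV.
(* Both clusters are estimated at the scale [D1] of V instead of their own diameters, so that all
   powers have one base and [defV] can add the exponents. *)
have IHA : \prod_(i in A) \prod_(j in A) w i j <=
    D1 `^ excess A * \prod_(v in A :\ m) prev_kernel A v.
  apply: IH => //.
  - by move=> j /sA; exact: minm.
  - by move=> i j /sA iV /sA; exact: leD1.
have IHB : \prod_(i in B) \prod_(j in B) w i j <=
    D1 `^ excess B * \prod_(v in B :\ m') prev_kernel B v.
  apply: IH => //.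
  by move=> i j /sB iV /sB; exact: leD1.
have BA : [disjoint B & A] by rewrite disjoint_sym.
have cAB := @cross_weight_le A B D1 D10 AB.
have cBA := @cross_weight_le B A D1 D10 BA.
have {}cAB := cAB (fun i j iA jB => introT andP
  (conj (crossD i j iA jB) (leD1 _ _ (sA _ iA) (sB _ jB)))).
have {}cBA : \prod_(i in B) \prod_(j in A) w i j <=
    D1 `^ (\sum_(i in B) \sum_(j in A) a i j).
  by apply: cBA => i j iB jA; rewrite dC crossD//=; exact: leD1 (sA _ jA) (sB _ iB).
rewrite (big_subset_pairs _ AV) /=.
apply: (le_trans (ler_pM _ _ (ler_pM _ _ IHA IHB) (ler_pM _ _ cAB cBA))).
  1-6: by rewrite ?mulr_ge0 ?mprod.
have -> : \prod_(v in V :\ m) prev_kernel V v =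
    (\prod_(v in A :\ m) prev_kernel V v) *
    ((\prod_(v in B :\ m') prev_kernel V v) * prev_kernel V m').
  rewrite (big_setID A)/=; congr (_ * _).
    apply: eq_bigl => i; rewrite !inE.
    by case: (boolP (i \in A)) => [/sA ->|_]; rewrite ?andbT ?andbF.
  rewrite mulrC -big_setD1//; apply: eq_bigl => i.
  rewrite !inE; have [->|//] := eqVneq i m.
  by rewrite mA.
(* [m'] has no factor in [IHB]. Its kernel over V contains the term of [m], which has a smaller
   label and lies within distance [D1]. *)
have kerB : D1 `^ (- th) <= prev_kernel V m'.
  have m'V := sB _ m'B.
  have mm' : m != m' by apply: contraTneq m'B => <-; rewrite !inE mA.
  rewrite /prev_kernel (bigD1 m)/=; last first.
    by rewrite mV ltn_neqAle minm// andbT.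
  apply: ler_wpDr; first by apply: sumr_ge0 => *; exact: powR_ge0.
  rewrite !powRN lef_pV2 ?posrE ?powR_gt0// ?d_gt0 1?eq_sym//.
  by apply: ge0_ler_powR => //; rewrite ?nnegrE ?leD1 ?ltW// d_gt0 1?eq_sym.
have defV : excess V = excess A + excess B + (\sum_(i in A) \sum_(j in B) a i j +
    \sum_(i in B) \sum_(j in A) a i j) + th.
  rewrite /excess (big_subset_pairs _ AV) /= -/B.
  have -> : #|V|.-1 = (#|A|.-1 + #|B|.-1).+1.
    by rewrite cardV -(prednK A_gt0) -(prednK B_gt0) addSn addnS.
  by rewrite -natr1 natrD; ring.
have ker_le (C : {set 'I_n}) c : C \subset V ->
    0 <= \prod_(v in C :\ c) prev_kernel C v <= \prod_(v in C :\ c) prev_kernel V v.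
  move=> CV; rewrite prodr_ge0 => [|*]; last exact: prev_kernel_ge0.
  by apply: ler_prod => i _; rewrite prev_kernel_ge0 le_prev_kernel.
have /andP[pA0 pA] := ker_le A m AV; have /andP[pB0 pB] := ker_le B m' BV.
(* The sign of the excess is what permits passing from the diameter to an upper bound of it. *)
have D1D u : 0 <= u -> D1 `^ u <= D `^ u.
  move=> u0; apply: ge0_ler_powR => //; rewrite ?nnegrE ?(ltW D10) ?(ltW D0)//.
  exact: leD.
have D1n u v : D1 `^ (u + v) = D1 `^ u * D1 `^ v.
  by rewrite powRD// (gt_eqF D10) implybT.
have EV0 : 0 <= excess V by apply: excess_ge0; apply/finset.set0Pn; exists m.
have Q0 : 0 <= (\prod_(v in A :\ m) prev_kernel A v) *
    ((\prod_(v in B :\ m') prev_kernel B v) * D1 `^ (- th)).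
  by rewrite !mulr_ge0// powR_ge0.
have -> : forall p q, D1 `^ excess A * p * (D1 `^ excess B * q) *
    (D1 `^ (\sum_(i in A) \sum_(j in B) a i j) *
     D1 `^ (\sum_(i in B) \sum_(j in A) a i j)) =
    D1 `^ excess V * (p * (q * D1 `^ (- th))).
  move=> p q; rewrite defV !D1n powRN; field.
  by rewrite gt_eqF// powR_gt0.
apply: ler_pM; rewrite ?powR_ge0//; first exact: D1D.
by apply: ler_pM; rewrite ?mulr_ge0 ?powR_ge0//; apply: ler_pM; rewrite ?powR_ge0.
Qed.

End WeightedMetric.

(** * The exponents attached to a colouring *)

(* Sum the inequalities m c ^ 2 >= (2 p + 1) m c - p (p + 1) with p = M %/ r; the
   Cauchy-Schwarz inequality is too weak for small M. *)
Lemma sum_sqr_colours (K M : nat) (m : 'I_K -> nat) (r := K.+1) :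
  (M = \sum_(c < K) m c)%N -> (0 < M)%N ->
  (M ^ 2 + r + (1 < M) <= r * (\sum_(c < K) m c ^ 2) + M)%N.
Proof.
move=> sM M0; pose p := (M %/ r)%N; pose d := (M %% r)%N.
have Md : M = (p * r + d)%N by rewrite /p /d -divn_eq.
have dr : (d < r)%N by rewrite /d ltn_mod.
have : ((2 * p + 1) * M <= \sum_(c < K) m c ^ 2 + K * (p * (p + 1)))%N.
  rewrite sM big_distrr/= -[X in (X * (p * _))%N](card_ord K) -sum_nat_const -big_split/=.
  apply: leq_sum => c _; case: (leqP (m c) p) => [/subnKC|/subnKC] <-; nia.
set S := (\sum_(c < K) _)%N => SM.
(* Apart from [1 < M], right minus left is (d - 1)(r - d) + r p (p + 2). For p = 0 this is at least
   1 as soon as d > 1; for p > 0 the second term outweighs the -r that occurs at d = 0. *)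
suff: (M ^ 2 + r + (1 < M) + r * (K * (p * (p + 1))) <= r * ((2 * p + 1) * M) + M)%N.
  by move: SM; clear; rewrite -(leq_pmul2l (ltn0Sn K)) -/r mulnDr; lia.
clear SM S sM m; clearbody p d; rewrite Md in M0 *; rewrite /r in dr M0 *.
clear Md M r.
case: p M0 => [|p] M0.
  rewrite !mul0n add0n !muln0 addn0 !add0n mul1n.
  rewrite mul0n add0n in M0.
  have [e dE] : exists e, d = e.+1 by exists d.-1; rewrite prednK.
  have [f KE] : exists f, K = (d + f)%N by exists (K - d)%N; rewrite subnKC.
  by rewrite KE dE; case: (posnP e) => [->|e0] /=; nia.
have /= : (nat_of_bool (1 < p.+1 * K.+1 + d) <= 1)%N by case: (1 < _)%N.
set b := nat_of_bool _; clearbody b => b1; nia.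
Qed.

(* With M = p r + d, use m c ^ 2 >= 2 p m c - p ^ 2 and
   m c (m c - 1) >= 2 p m c - p (p + 1) if d <= s, and the analogous inequalities
   centred half a unit higher otherwise. *)
Lemma sum_sqr_root_colours (K M s : nat) (m : 'I_K -> nat) (t : 'I_K -> bool) (r := K.+1) :
  (M = \sum_(c < K) m c)%N -> (s = \sum_(c < K) ~~ t c)%N -> (0 < M)%N ->
  (M ^ 2 + r * (\sum_(c < K) ~~ t c * m c) < r * (\sum_(c < K) m c ^ 2) + M * s.+1)%N.
Proof.
move=> sM ss M0; pose p := (M %/ r)%N; pose d := (M %% r)%N.
have Md : M = (p * r + d)%N by rewrite /p /d -divn_eq.
have dr : (d < r)%N by rewrite /d ltn_mod.
have sK : (s <= K)%N.
  rewrite ss -[X in (_ <= X)%N]card_ord -sum1_card.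
  by apply: leq_sum => c _; case: (t c).
set S0 := (\sum_(c < K) _ * _)%N.
set S := (\sum_(c < K) _ ^ 2)%N.
have KE q : (K * q = \sum_(c < K) q)%N by rewrite sum_nat_const card_ord.
have [ds|ds] := ltnP d s.+1.
  have SM : (2 * p * M + S0 <= S + (K * p ^ 2 + p * s))%N.
    rewrite sM ss KE !big_distrr/= -!big_split/=.
    apply: leq_sum => c _.
    by case: (t c) => /=; case: (leqP (m c) p) => [/subnKC|/subnKC] <-; nia.
  (* Right minus left is r p (p + 1) + d (s + 1 - d), where d <= s and p, d are not both 0. *)
  suff: (M ^ 2 + r * (K * p ^ 2 + p * s) < r * (2 * p * M) + M * s.+1)%N.
    by move: SM; clear; rewrite -(leq_pmul2l (ltn0Sn K)) -/r !(mulnDr r); lia.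
  clear SM S S0 sM ss m t KE; clearbody p d; rewrite Md in M0 *; rewrite /r in dr M0 *.
  clear Md M r.
  have [|p0] := posnP p; last nia.
  by move=> p0; rewrite p0 in M0 *; nia.
have SM : ((2 * p + 1) * M + S0 + (K - s) * p.+1 <= S + K * p.+1 ^ 2)%N.
  have -> : (K - s = \sum_(c < K) t c)%N.
    suff KE' : (K = \sum_(c < K) t c + s)%N by rewrite {1}KE' addnK.
    rewrite ss -big_split/= -[LHS]card_ord -sum1_card.
    by apply: eq_bigr => c _; case: (t c).
  rewrite sM KE big_distrl !big_distrr/= -!big_split/=.
  apply: leq_sum => c _.
    by case: (t c) => /=; case: (leqP (m c) p) => [/subnKC|/subnKC] <-; nia.
(* Right minus left is r p (p + 2) + (d - s)(r - d) + d, where s < d < r. *)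
suff: (M ^ 2 + r * (K * p.+1 ^ 2) < r * ((2 * p + 1) * M) + r * ((K - s) * p.+1) + M * s.+1)%N.
  by move: SM; clear; rewrite -(leq_pmul2l (ltn0Sn K)) -/r !(mulnDr r); lia.
clear SM S S0 sM ss m t KE; clearbody p d; rewrite Md in M0 *; rewrite /r in dr M0 *.
clear Md M r M0.
have [u uE] : exists u, (K = s + u)%N by exists (K - s)%N; lia.
have -> : (K - s = u)%N by lia.
have [e eE] : exists e, (d + e = K.+1)%N by exists (K.+1 - d)%N; lia.
subst K; nia.
Qed.

Section RootedExponents.
Context {R : realType} {N : nat}.

Definition rooted (c : 'I_N -> R) (b : 'I_N -> 'I_N -> R) (i j : 'I_N.+1) : R :=
  match unlift ord0 i, unlift ord0 j with
  | Some i', Some j' => b i' j'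
  | Some i', None | None, Some i' => c i'
  | None, None => 0
  end.

Lemma rooted_lift c b i j : rooted c b (lift ord0 i) (lift ord0 j) = b i j.
Proof. by rewrite /rooted !liftK. Qed.

Lemma rooted_root c b i : rooted c b ord0 (lift ord0 i) = c i.
Proof. by rewrite /rooted liftK unlift_none. Qed.

Lemma rooted_lift_root c b i : rooted c b (lift ord0 i) ord0 = c i.
Proof. by rewrite /rooted liftK unlift_none. Qed.

Lemma rooted_root_root c b : rooted c b ord0 ord0 = 0.
Proof. by rewrite /rooted unlift_none. Qed.

Definition rooted_rw := (rooted_lift, rooted_root, rooted_lift_root, rooted_root_root).

Definition nonroots (V : {set 'I_N.+1}) : {set 'I_N} := [set i | lift ord0 i \in V]%SET.

Lemma big_nonroots {S : Type} {idx : S} {op : Monoid.com_law idx}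
    (V : {set 'I_N.+1}) (F : 'I_N.+1 -> S) :
  \big[op/idx]_(i in V) F i = op (if ord0 \in V then F ord0 else idx)
    (\big[op/idx]_(i in nonroots V) F (lift ord0 i)).
Proof.
rewrite big_mkcond big_ord_recl [in RHS]big_mkcond; congr (op _ _).
by apply: eq_bigr => i _; rewrite inE.
Qed.

Lemma card_nonroots (V : {set 'I_N.+1}) : #|V| = ((ord0 \in V) + #|nonroots V|)%N.
Proof. by rewrite -!sum1_card big_nonroots; case: ifP. Qed.

Lemma sum_rooted c b (V : {set 'I_N.+1}) :
  \sum_(i in V) \sum_(j in V) rooted c b i j =
  (ord0 \in V)%:R * (\sum_(i in nonroots V) c i) *+ 2 +
  \sum_(i in nonroots V) \sum_(j in nonroots V) b i j.
Proof.
have rowE i : \sum_(j in V) rooted c b i j = (if ord0 \in V then rooted c b i ord0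
    else 0) + \sum_(j in nonroots V) rooted c b i (lift ord0 j).
  exact: big_nonroots.
rewrite (eq_bigr _ (fun i _ => rowE i)) big_nonroots/= !rooted_rw.
under [\sum_(j in _) rooted _ _ ord0 _]eq_bigr do rewrite rooted_rw.
have -> : \sum_(i in nonroots V) ((if ord0 \in V then rooted c b (lift ord0 i) ord0
      else 0) + \sum_(j in nonroots V) rooted c b (lift ord0 i) (lift ord0 j)) =
    (ord0 \in V)%:R * (\sum_(i in nonroots V) c i) +
    \sum_(i in nonroots V) \sum_(j in nonroots V) b i j.
  rewrite big_split/=; congr (_ + _).
    rewrite big_distrr/=; apply: eq_bigr => i _; rewrite rooted_rw.
    by case: (ord0 \in V); rewrite ?mul1r ?mul0r.
  by apply: eq_bigr => i _; apply: eq_bigr => j _; rewrite rooted_rw.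
by case: (ord0 \in V); rewrite ?mul1r ?mul0r; ring.
Qed.

Variables (K s : nat) (col : 'I_N -> 'I_K) (t : 'I_K -> bool).
Hypothesis ts : (s = \sum_(c < K) ~~ t c)%N.
Hypothesis KN : (K < N)%N.
Let r := K.+1.

(* K = r - 1; pair_expo and root_expo are halved since every pair is counted
   twice. *)
Definition pair_expo (i j : 'I_N) : R :=
  if i == j then 0 else (col i == col j)%:R - r%:R^-1.

Definition root_expo (i : 'I_N) : R := (s%:R / r%:R - 1 + (t (col i))%:R) / 2.

(* r times the exponents is integral, which leaves a slack of 1 / r, to be shared
   by at most N mergings. *)
Definition decay : R := 1 - (r%:R * N%:R)^-1.

Implicit Types W : {set 'I_N}.

Let mult (W : {set 'I_N}) (c : 'I_K) := #|[set i in W | col i == c]%SET|.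

Lemma sum_mult W (G : 'I_K -> nat) :
  (\sum_(i in W) G (col i) = \sum_(c < K) G c * mult W c)%N.
Proof.
rewrite (partition_big col xpredT)//=; apply: eq_bigr => c _.
rewrite /mult -sum1_card big_distrr/=.
apply: eq_big => [i|i /andP[_ /eqP ->]]; first by rewrite inE.
by rewrite muln1.
Qed.

Lemma sum_pair_expo W : \sum_(i in W) \sum_(j in W) pair_expo i j =
  (\sum_(c < K) mult W c ^ 2)%N%:R - #|W|%:R - #|W|%:R * (#|W|%:R - 1) / r%:R.
Proof.
have pE i j : pair_expo i j = (col i == col j)%:R - r%:R^-1 - (i == j)%:R * (1 - r%:R^-1).
  by rewrite /pair_expo; case: eqVneq => [->|_]; rewrite ?eqxx /=; ring.
have sumE i : i \in W -> \sum_(j in W) pair_expo i j =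
    (mult W (col i))%:R - #|W|%:R / r%:R - (1 - r%:R^-1).
  move=> iW; under eq_bigr do rewrite pE.
  rewrite !sumrB sumr_const; congr (_ - _ - _).
  - rewrite -natr_sum; congr _%:R.
    rewrite /mult -sum1_card big_mkcond/= [RHS]big_mkcond/=.
    by apply: eq_bigr => j _; rewrite inE eq_sym; case: (j \in W) => //=; case: eqP.
  - by rewrite mulr_natl.
  - rewrite -big_distrl/= (bigD1 i)//= eqxx big1 ?addr0 ?mul1r// => j /andP[_ ji].
    by rewrite eq_sym (negbTE ji).
have sumc (x : R) : \sum_(i in W) x = #|W|%:R * x by rewrite sumr_const mulr_natl.
rewrite (eq_bigr _ sumE) !sumrB !sumc -natr_sum sum_mult.
under eq_bigr do rewrite mulnn.
by ring.
Qed.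

Lemma sum_root_expo W : (\sum_(i in W) root_expo i) *+ 2 =
  #|W|%:R * (s%:R / r%:R) - (\sum_(c < K) ~~ t c * mult W c)%N%:R.
Proof.
rewrite -sumrMnl -sum_mult natr_sum.
transitivity (\sum_(i in W) (s%:R / r%:R - (~~ t (col i))%:R : R)).
  apply: eq_bigr => i _; rewrite /root_expo.
  by move: (s%:R / _) => q; case: (t _) => /=; field.
by rewrite sumrB; congr (_ - _); rewrite sumr_const [RHS]mulr_natl.
Qed.

Lemma decay_itv : 0 <= decay < 1.
Proof.
have N0 : (0 < N)%N by apply: leq_ltn_trans KN.
have rN : 1 <= r%:R * N%:R :> R by rewrite -natrM ler1n muln_gt0.
have rN0 : 0 < r%:R * N%:R :> R by apply: lt_le_trans rN.
by rewrite /decay subr_ge0 invf_le1// rN/= gtrBl invr_gt0.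
Qed.

Lemma excess_rooted_ge0 (V : {set 'I_N.+1}) : V != finset.set0 ->
  0 <= excess (rooted root_expo pair_expo) decay V.
Proof.
move=> V0; rewrite /excess sum_rooted -mulrnAr sum_root_expo sum_pair_expo.
set W := nonroots V; set M := #|W|.
have MN : (M <= N)%N by rewrite -[X in (_ <= X)%N]card_ord max_card.
have sM : (M = \sum_(c < K) mult W c)%N.
  by rewrite /M -sum1_card (sum_mult W (fun=> 1%N)); apply: eq_bigr => c _; rewrite mul1n.
have r0 : 0 < r%:R :> R by rewrite ltr0n.
have rE : r%:R = K%:R + 1 :> R by rewrite natr1.
have N0 : 0 < N%:R :> R by rewrite ltr0n; exact: leq_ltn_trans KN.
have cardV : #|V| = ((ord0 \in V) + M)%N by rewrite card_nonroots.
have := V0; rewrite -card_gt0 cardV /decay.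
have MN' : M%:R / N%:R <= 1 :> R by rewrite ler_pdivrMr// mul1r ler_nat.
rewrite -(pmulr_rge0 _ r0).
have [M0|M0] := posnP M.
  rewrite M0; case: (ord0 \in V) => //= _.
  have -> : (\sum_(c < K) mult W c ^ 2 = 0)%N.
    rewrite big1// => c _; apply/eqP; rewrite expn_eq0 andbT -leqn0 -[X in (_ <= X)%N]M0 sM.
    by rewrite (bigD1 c)//= leq_addr.
  have -> : (\sum_(c < K) ~~ t c * mult W c = 0)%N.
    apply/eqP; rewrite -leqn0 -[X in (_ <= X)%N]M0 sM leq_sum// => c _.
    by case: (t c); rewrite ?mul1n.
  by rewrite !(mul0r, mulr0, subr0, addr0).
case: (ord0 \in V) => /= _.
  have := sum_sqr_root_colours sM ts M0.
  set S := (\sum_(c < K) _ ^ 2)%N; set S' := (\sum_(c < K) _ * _)%N.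
  rewrite -(ler_nat R) -natr1 -/r => h; rewrite !natrD !natrM in h.
  rewrite add0n.
  have -> : r%:R * (1 * (M%:R * (s%:R / r%:R) - S'%:R) +
       (S%:R - M%:R - M%:R * (M%:R - 1) / r%:R) + (1 - (r%:R * N%:R)^-1) * M%:R)
    = (r%:R * S%:R + M%:R * (s%:R + 1) - M%:R ^+ 2 - r%:R * S'%:R) - M%:R / N%:R :> R.
    by field; rewrite !gt_eqF.
  rewrite -natr1 in h; rewrite rE; lra.
have := sum_sqr_colours sM M0.
set S := (\sum_(c < K) _ ^ 2)%N.
rewrite -(ler_nat R) -/r => h; rewrite !natrD !natrM in h.
rewrite add0n.
have -> : M.-1%:R = M%:R - 1 :> R by rewrite -[in RHS](prednK M0) -natr1; ring.
rewrite mul0r add0r.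
have -> : r%:R * (S%:R - M%:R - M%:R * (M%:R - 1) / r%:R +
    (1 - (r%:R * N%:R)^-1) * (M%:R - 1)) =
    r%:R * S%:R + M%:R - M%:R ^+ 2 - r%:R - (M%:R - 1) / N%:R :> R.
  by field; rewrite !gt_eqF.
(* The left side is the loss due to [decay] < 1. It vanishes for a single point, whose excess is
   exactly 0; otherwise the unit gained in [sum_sqr_colours] pays for it. *)
have : (M%:R - 1) / N%:R <= (1 < M)%:R :> R.
  have [M1|M1] := ltnP 1 M.
    by rewrite ler_pdivrMr// mul1r lerBlDr (le_trans (_ : M%:R <= N%:R))// ?ler_nat// lerDl.
  by rewrite (_ : M = 1%N) ?subrr ?mul0r//; lia.
rewrite rE; rewrite ?rE in h; lra.
Qed.

End RootedExponents.

(** * The generators of the ideal *)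

Section PartitionPolynomials.
Context {A B : comNzRingType} (phi : {rmorphism A -> B}).

Lemma Delta_rmorph (x : seq A) : phi (Delta x) = Delta (map phi x).
Proof.
rewrite /Delta rmorph_prod size_map; apply: eq_bigr => i _.
rewrite rmorph_prod; apply: eq_bigr => j _.
by rewrite rmorphB/= !(nth_map 0).
Qed.

(** Serves for three morphisms: the permutation of the variables, the evaluation, and the embedding
    of the reals into the complex numbers. *)
Lemma p_part_set_rmorph nu k (T : {set 'I_k}) (x : seq A) :
  phi (p_part_set nu T x) = p_part_set nu T (map phi x).
Proof.
rewrite /p_part_set rmorphM/= /Defs.p_part !rmorph_prod; congr (_ * _).
  have -> : [seq a ^+ 2 | a <- map phi x] = map phi [seq a ^+ 2 | a <- x].
    by rewrite -!map_comp; apply: eq_map => a /=; rewrite rmorphXn.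
  rewrite /Defs.p_part -[reshape nu (map phi _)](map_reshape phi nu) big_map.
  by apply: eq_bigr => b _; rewrite Delta_rmorph.
apply: eq_bigr => j _; rewrite -[reshape nu (map phi _)](map_reshape phi nu) rmorph_prod.
have [jl|jl] := ltnP j (size (reshape nu x)); first by rewrite (nth_map [::])// big_map.
by rewrite !nth_default ?size_map// !big_nil.
Qed.
End PartitionPolynomials.

Lemma msymXU {n : nat} {R : comNzRingType} (s : 'S_n) (i : 'I_n) :
  msym s ('X_i : {mpoly R[n]}) = 'X_(s i).
Proof.
rewrite msymX; congr 'X_[_]; apply/mnmP => j; rewrite mnmE !mnm1E.
by rewrite -(inj_eq (@perm_inj _ s)) permKV.
Qed.

Lemma sqr_prod_lt_pairs {R : comPzRingType} {n : nat} (G : 'I_n -> 'I_n -> R) :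
  (forall i j, G i j = G j i) ->
  (\prod_(i < n) \prod_(j < n | (i < j)%N) G i j) ^+ 2 =
  \prod_(i < n) \prod_(j < n | j != i) G i j.
Proof.
move=> GC; rewrite expr2 {2}(exchange_big_dep xpredT)//= -big_split/=.
apply: eq_bigr => i _; rewrite [RHS](bigID (fun j : 'I_n => (i < j)%N))/=.
congr (_ * _); first by apply: eq_bigl => j; rewrite neq_ltn orbC andb_idl// => ->.
under eq_bigr do rewrite GC.
by apply: eq_bigl => j; rewrite -leqNgt ltn_neqAle.
Qed.

Lemma Delta_sqr {R : realDomainType} {T : eqType} (h : T -> R) (b : seq T) : uniq b ->
  Delta (map h b) ^+ 2 = \prod_(i <- b) \prod_(j <- b | j != i) `|h i - h j|.
Proof.
move=> ub; rewrite -real_normK ?num_real// /Delta normr_prod.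
case: b ub => [|x0 b'] ub; first by rewrite !big_nil big_ord0 expr1n.
set b := x0 :: b' in ub *.
under eq_bigr do rewrite normr_prod.
rewrite sqr_prod_lt_pairs; last by move=> i j; rewrite distrC.
rewrite size_map (big_nth x0) big_mkord; apply: eq_bigr => i _.
rewrite (big_nth x0) big_mkord; apply: eq_big => [j|j _]; first by rewrite nth_uniq.
by rewrite !(nth_map x0).
Qed.

Lemma find_uniq_flatten {T : eqType} (B : seq (seq T)) x c :
  uniq (flatten B) -> x \in nth [::] B c -> find (fun b : seq T => x \in b) B = c.
Proof.
elim: B c => [|b B IH] [|c] //=; first by move=> _ ->.
rewrite cat_uniq => /and3P[_ /hasPn bB uB] xc.
have xB : x \in flatten B.
  apply/flattenP; exists (nth [::] B c) => //; apply: mem_nth.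
  by rewrite ltnNge; apply: contraL xc => /(nth_default _) ->.
by rewrite (negbTE (bB _ xB)) (IH c).
Qed.

Lemma uniq_nth_flatten {T : eqType} (B : seq (seq T)) c :
  uniq (flatten B) -> uniq (nth [::] B c).
Proof.
elim: B c => [|b B IH] [|c] //=; rewrite cat_uniq => /and3P[]// _ _.
exact: IH.
Qed.

Lemma sumn_nu_part N k : (0 < k)%N -> sumn (nu_part N k) = N.
Proof.
move=> k0; rewrite /nu_part sumn_cat !sumn_nseq.
have := ltn_pmod N k0; have := divn_eq N k.
by move: (N %/ k)%N (N %% k)%N => q t Nq tk; nia.
Qed.

Lemma size_nu_part N k : (0 < k)%N -> size (nu_part N k) = k.
Proof. by move=> k0; rewrite size_cat !size_nseq subnKC// ltnW// ltn_pmod. Qed.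

(** The colour of a variable is the index of the block into which the permutation puts it; the
    estimates retain nothing else of the partition and the permutation. Squaring turns each pair of
    a block into its two ordered pairs. *)
Lemma p_part_set_colouring {R : realDomainType} N k (T : {set 'I_k}) (s : 'S_N) :
  (0 < k)%N -> exists col : 'I_N -> 'I_k, forall x : 'I_N -> R,
    p_part_set (nu_part N k) T [seq x (s i) | i <- enum 'I_N] ^+ 2 =
    (\prod_i \prod_(j | (j != i) && (col j == col i)) `|x i ^+ 2 - x j ^+ 2|) *
    \prod_(i | col i \in T) x i ^+ 2.
Proof.
move=> k0; pose idx := [seq s i | i <- enum 'I_N].
pose B := reshape (nu_part N k) idx.
have sB : size B = k by rewrite size_reshape size_nu_part.
have fB : flatten B = idx.
  by rewrite reshapeKr// size_map size_enum_ord sumn_nu_part.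
have ufB : uniq (flatten B) by rewrite fB map_inj_uniq ?enum_uniq//; exact: perm_inj.
have hasB i : has (fun b : seq 'I_N => i \in b) B.
  have : i \in flatten B.
    by rewrite fB -(permKV s i) map_f// mem_enum.
  by move=> /flattenP[b bB ib]; apply/hasP; exists b.
have colP i : (find (fun b : seq 'I_N => i \in b) B < k)%N by rewrite -sB -has_find.
pose col i : 'I_k := Ordinal (colP i).
have colE i c : (i \in nth [::] B c) = (col i == c :> nat).
  apply/idP/eqP => [|<-] /=; first exact: find_uniq_flatten.
  exact: (@nth_find _ [::] (fun b : seq 'I_N => i \in b) B (hasB i)).
have nthB c (F : 'I_N -> R) : \prod_(i <- nth [::] B c) F i = \prod_(i | col i == c :> nat) F i.
  by rewrite big_uniq ?uniq_nth_flatten//; apply: eq_bigl => i; rewrite colE.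
have mapE (S : Type) (h : 'I_N -> S) : [seq h (s i) | i <- enum 'I_N] = map h idx.
  exact: (map_comp h s).
exists col => x; rewrite /p_part_set exprMn; congr (_ * _).
  rewrite -map_comp (mapE _ (fun i => x i ^+ 2)) /Defs.p_part -map_reshape big_map -prodrXl.
  rewrite (big_nth [::]) sB big_mkord [RHS](partition_big col xpredT)//=.
  apply: eq_bigr => c _; rewrite Delta_sqr ?uniq_nth_flatten// nthB; apply: eq_bigr => i /eqP ic.
  rewrite big_mkcond nthB -big_mkcondr/=; apply: eq_bigl => j.
  by rewrite [LHS]andbC -ic.
rewrite mapE -map_reshape -prodrXl [RHS](partition_big col (mem T))//=.
apply: eq_bigr => c cT; rewrite (nth_map [::]) ?sB// big_map -prodrXl nthB.
by apply: eq_bigl => i; rewrite andb_idl// => /eqP ->.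
Qed.

Lemma msym_p_part_set {R : realType} N k (T : {set 'I_k}) (s : 'S_N) (x : 'I_N -> R) :
  (msym s (p_part_set (nu_part N k) T [seq 'X_i | i <- enum 'I_N])).@[fun i => (x i)%:C]
  = (p_part_set (nu_part N k) T [seq x (s i) | i <- enum 'I_N])%:C.
Proof.
rewrite !p_part_set_rmorph -!map_comp; congr p_part_set.
by apply: eq_map => i /=; rewrite msymXU mevalXU.
Qed.

(** * Integration of the majorant *)

Section PowerKernel.
Context {R : realType}.
Variable th : R.
Hypothesis th_itv : 0 <= th < 1.

Let q : R := 2^-1 `^ (1 - th).

Lemma powR_dyadic_le (t : R) : 0 <= t -> 1 < t `^ (- th) ->
  exists k : nat, t <= 2^-1 ^+ k /\ t `^ (- th) <= 2 `^ th * (2 `^ th) ^+ k.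
Proof.
case/andP: th_itv => th0 th1 t0 t1.
have tgt0 : 0 < t.
  rewrite lt0r t0 andbT; apply: contraTneq t1 => ->.
  have [->|n0] := eqVneq (- th) 0; first by rewrite powRr0 ltxx.
  by rewrite powR0// ltr10.
have tlt1 : t < 1.
  rewrite ltNge; apply: contraL t1 => t1; rewrite -leNgt powRN invf_le1 ?powR_gt0//.
  apply: (@le_trans _ _ (1 `^ th)); first by rewrite powR1.
  by rewrite ge0_ler_powR// nnegrE ler01.
have ex : exists n : nat, 2^-1 ^+ n < t.
  have [n _ /(_ n (leqnn n))] := near_infty_natSinv_expn_lt (PosNum tgt0).
  by rewrite /= div1r -exprVn; exists n.
case: (ex_minnP ex) => -[|k]; first by rewrite expr0 ltNge (ltW tlt1).
move=> tk kmin; exists k; split.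
  by rewrite leNgt; apply/negP => /kmin; rewrite ltnn.
have powV n : (2^-1 ^+ n) `^ th = ((2 `^ th) ^+ n)^-1 :> R.
  elim: n => [|n IH]; first by rewrite !expr0 powR1 invr1.
  rewrite !exprS powRM ?exprn_ge0// IH invfM; congr (_ * _).
  by rewrite -powR_inv1// powRAC powR_inv1// powR_ge0.
rewrite -exprS -[leRHS]invrK -powV powRN lef_pV2 ?posrE ?powR_gt0 ?exprn_gt0//.
by apply: ge0_ler_powR; rewrite ?nnegrE ?exprn_ge0// ltW.
Qed.

(** The integrand is at most 1 plus the sum over k of 2^th 2^(th k) times the indicator of the ball
    of radius 2^-k about w. The constant 1 contributes 2 M, and the k-th ball at most 2 * 2^th q^k
    with q = 2^(th - 1) < 1, whatever w is. *)
Lemma integral_powR_dist (M : R) : 0 < M -> exists C : R, forall w : R,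
  (\int[@lebesgue_measure R]_(x in `[(- M)%R, M]%classic) ((`|x - w| `^ (- th))%R%:E)
    <= C%:E)%E.
Proof.
move=> M0; exists (M *+ 2 + 2 `^ th * 2 * (1 - q)^-1) => w.
have /andP[th0 th1] := th_itv.
set D : set (measurableTypeR R) := `[- M, M]%classic.
pose c k : R := 2 `^ th * (2 `^ th) ^+ k.
pose B k : set (measurableTypeR R) := closed_ball w (2^-1 ^+ k).
have mD : measurable D by exact: measurable_itv.
have c0 k : 0 <= c k by rewrite /c mulr_ge0 ?exprn_ge0 ?powR_ge0.
have mB k : measurable (B k).
  by rewrite /B closed_ball_itv ?exprn_gt0.
pose g k (x : measurableTypeR R) : \bar R := (c k * \1_(B k) x)%:E.
have g0 k x : (0 <= g k x)%E by rewrite lee_fin mulr_ge0.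
have mg k : measurable_fun D (g k).
  apply/measurable_EFinP; exact: measurable_funM.
have le_g x : ((`|x - w| `^ (- th))%:E <= 1 + \sum_(k <oo) g k x)%E.
  have s0 : (0 <= \sum_(k <oo) g k x)%E by apply: nneseries_ge0.
  have [le1|gt1] := leP (`|x - w| `^ (- th)) 1.
    by rewrite -[leLHS]adde0 leeD.
  have [k [xk tk]] := powR_dyadic_le (normr_ge0 _) gt1.
  apply: (@le_trans _ _ (\sum_(k <oo) g k x)%E); last by rewrite leeDr.
  apply: le_trans (nneseries_lim_ge k.+1 _) => //.
  rewrite big_nat_recr//=; apply: (@le_trans _ _ (g k x)).
    rewrite lee_fin indicE mem_set ?mulr1//.
    by rewrite /B closed_ballE ?exprn_gt0//= /closed_ball_ /= distrC.
  by rewrite leeDr// sume_ge0.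
have q0 : 0 < q by rewrite powR_gt0.
have q1 : q < 1.
  apply: (@lt_le_trans _ _ (1 `^ (1 - th))); last by rewrite powR1.
  by rewrite gt0_ltr_powR ?nnegrE ?subr_gt0//; lra.
apply: (@le_trans _ _ (\int[lebesgue_measure]_(x in D) (1 + \sum_(k <oo) g k x))%E).
  apply: ge0_le_integral => //.
  - apply/measurable_EFinP; apply: (measurableT_comp (measurable_powR _)).
    by apply: measurableT_comp => //; apply: measurable_funB.
  - by apply: emeasurable_funD => //; exact: ge0_emeasurable_sum.
rewrite ge0_integralD//; [|by move=> x _; exact: nneseries_ge0|exact: ge0_emeasurable_sum].
rewrite EFinD leeD//.
  rewrite integral_cst// mul1e /D.
  rewrite [leLHS](lebesgue_measure_itv `[- M, M])/= lte_fin gtrN// -EFinD opprK.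
  by rewrite -mulr2n.
rewrite integral_nneseries//.
apply: lime_le; first by apply: is_cvg_nneseries => n _ _; apply: integral_ge0.
apply: nearW => n; apply: (@le_trans _ _ (series (geometric (2 `^ th * 2) q) n)%:E).
  rewrite /series/= -sumEFin; apply: lee_sum => k _.
  have mI : measurable_fun D (fun x => (\1_(B k) x)%:E : \bar R) by exact/measurable_EFinP.
  have -> : (\int[lebesgue_measure]_(x in D) g k x =
      (c k)%:E * \int[lebesgue_measure]_(x in D) (\1_(B k) x)%:E)%E.
    by rewrite -ge0_integralZl_EFin//; apply: eq_integral => x _; rewrite /g EFinM.
  rewrite integral_indic// [leRHS](_ : _ = (c k)%:E * (2^-1 ^+ k *+ 2)%:E)%E.
    rewrite lee_wpmul2l ?lee_fin//.
    rewrite -(@lebesgue_measure_closed_ball _ w (2^-1 ^+ k)) ?exprn_ge0//.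
    apply: le_measure; [rewrite inE|rewrite inE|exact: subIsetl].
      by apply: measurableI => //; exact: mB.
    exact: mB.
  rewrite -EFinM /geometric/= /c; congr EFin.
  have -> : q = 2 `^ th * 2^-1.
    rewrite /q powRB; last by rewrite invr_eq0 pnatr_eq0 implybT.
    rewrite powRr1 ?invr_ge0// mulrC; congr (_ * _).
    by rewrite -powR_inv1// powRAC powR_inv1 ?powR_ge0// invrK.
  by rewrite exprMn; ring.
rewrite lee_fin; by apply: geometric_le_lim => //; rewrite ger0_norm// ltW.
Qed.

End PowerKernel.

Section IntegralRV.
Context {R : realType}.

Lemma ge0_integral_rVS n (f : 'rV[R]_n.+1 -> \bar R) :
  measurable_fun setT f -> (forall x, (0 <= f x)%E) ->
  (\int[lebesgue_rV n.+1]_x f x =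
   \int[@lebesgue_measure R]_a \int[lebesgue_rV n]_v f (rVcons (a, v)))%E.
Proof.
move=> mf f0.
have mcons := @measurable_rVcons R n.
transitivity (\int[pushforward (@lebesgue_measure R \x lebesgue_rV n)%E
    (@rVcons R n)]_x f x)%E.
  exact: eq_measure_integral.
rewrite ge0_integral_pushforward//= preimage_setT.
rewrite fubini_tonelli1//; exact: measurableT_comp.
Qed.

Variables (k : R -> R -> R) (C : R).
Hypothesis k_ge0 : forall x w, 0 <= k x w.
Hypothesis k_meas : measurable_fun [set: measurableTypeR R * measurableTypeR R]
  (fun p => k p.1 p.2 : measurableTypeR R).
Hypothesis k_int : forall w,
  (\int[@lebesgue_measure R]_x (k x w)%:E <= C%:E)%E.

(* h lists the points integrated earlier, seen as constants. *)
Definition chain n (h : seq R) (x : 'rV[R]_n) : R :=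
  \prod_(i < n) (\sum_(w <- h) k (x 0 i) w + \sum_(j < n | (j < i)%N) k (x 0 i) (x 0 j)).

Lemma chain_ge0 n h (x : 'rV[R]_n) : 0 <= chain h x.
Proof. by apply: prodr_ge0 => i _; rewrite addr_ge0// sumr_ge0. Qed.

Lemma chain_rVcons n h a (v : 'rV[R]_n) :
  chain h (rVcons (a, v)) = (\sum_(w <- h) k a w) * chain (a :: h) v.
Proof.
rewrite /chain big_ord_recl rVcons0/= [X in _ + X]big1 ?addr0//; congr (_ * _).
apply: eq_bigr => i _; rewrite rVconsS/= big_cons.
rewrite [X in _ + X = _]big_mkcond big_ord_recl/= rVcons0.
rewrite addrCA addrA; congr (_ + _).
by rewrite [RHS]big_mkcond; apply: eq_bigr => j _; rewrite rVconsS.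
Qed.

Lemma measurable_k1 w : measurable_fun [set: measurableTypeR R]
  (fun x => k x w : measurableTypeR R).
Proof. exact: (measurableT_comp k_meas (measurable_pair2 w)). Qed.

Lemma measurable_chain n h : measurable_fun [set: 'rV[R]_n]
  (fun x => chain h x : measurableTypeR R).
Proof.
apply: measurable_prod => i _; apply: measurable_funD.
  apply: measurable_sum => w.
  exact: (measurableT_comp (measurable_k1 w) (measurable_coord i)).
under eq_fun do rewrite -big_filter.
apply: measurable_sum => j.
have mij : measurable_fun [set: 'rV[R]_n]
    (fun x => (x 0 i, x 0 j) : measurableTypeR R * measurableTypeR R).
  by apply/measurable_fun_pairP; split; exact: measurable_coord.
exact: (measurableT_comp k_meas mij).
Qed.

(** The bound may depend on [h] only through its length: the inner integral, where the outer
    variable has joined [h], is then bounded uniformly in that variable. Unfolded, the bound is m (m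
    + 1) ... (m + n - 1) C^n. *)
Lemma integral_chain_fin n m : exists2 B : R, 0 <= B & forall h, size h = m ->
  (\int[lebesgue_rV n]_x (chain h x)%:E <= B%:E)%E.
Proof.
have C0 : 0 <= C.
  by rewrite -lee_fin; apply: le_trans (k_int 0); apply: integral_ge0 => x _; rewrite lee_fin.
elim: n m => [|n IH] m.
  exists 1 => // h _; rewrite /= integral_dirac//.
    by rewrite diracT mul1e /chain big_ord0.
  by apply/measurable_EFinP; exact: measurable_chain.
have [B B0 IHB] := IH m.+1; exists (m%:R * C * B) => [|h hm].
  by rewrite !mulr_ge0.
have mch l (h' : seq R) : measurable_fun [set: 'rV[R]_l] (fun x => (chain h' x)%:E).
  by apply/measurable_EFinP; exact: measurable_chain.
have mk w : measurable_fun [set: measurableTypeR R] (fun x => (k x w)%:E).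
  by apply/measurable_EFinP; exact: measurable_k1.
have ch0 l h' (x : 'rV[R]_l) : (0 <= (chain h' x)%:E)%E by rewrite lee_fin chain_ge0.
rewrite ge0_integral_rVS//.
apply: (@le_trans _ _ (\int[@lebesgue_measure R]_a (B%:E * (\sum_(w <- h) (k a w)%:E)%E))%E).
  apply: ge0_le_integral => //.
  - by move=> a _; apply: integral_ge0 => v _.
  - apply: (@measurable_fun_fubini_tonelli_F _ _ _ _ _ _ (fun p => (chain h (rVcons p))%:E)).
      by apply: (measurableT_comp (mch _ _)); exact: measurable_rVcons.
    by move=> p; exact: ch0.
  - by apply: measurable_funeM; apply: emeasurable_sum.
  move=> a _; under eq_integral do rewrite chain_rVcons EFinM.
  have s0 : 0 <= \sum_(w <- h) k a w by exact: sumr_ge0.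
  rewrite ge0_integralZl_EFin//; last exact: mch.
  rewrite muleC sumEFin; apply: lee_wpmul2r; first by rewrite lee_fin.
  by apply: IHB; rewrite /= hm.
have s0 a : (0 <= \sum_(w <- h) (k a w)%:E)%E.
  by apply: sume_ge0 => w _; rewrite lee_fin.
rewrite ge0_integralZl_EFin//; last exact: emeasurable_sum.
rewrite ge0_integral_sum//; last by move=> w a _; rewrite lee_fin.
rewrite muleC EFinM; apply: lee_wpmul2r; first by rewrite lee_fin.
apply: (@le_trans _ _ (\sum_(w <- h) C%:E)%E); first by apply: lee_sum.
by rewrite sumEFin lee_fin big_const_seq count_predT hm iter_addr_0 mulr_natl.
Qed.

End IntegralRV.

Section SymmetricKernel.
Context {R : realType}.
Variables (th M : R).
Hypotheses (th_itv : 0 <= th < 1) (M1 : 1 <= M).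

(** The cut-off is part of the kernel, so that the chain can be integrated over the whole space. *)
Definition sym_kernel (x w : R) : R :=
  \1_(`[- M, M]%classic : set R) x * (`|x - w| `^ (- th) + `|x + w| `^ (- th)).

Lemma sym_kernel_ge0 x w : 0 <= sym_kernel x w.
Proof. by rewrite mulr_ge0// addr_ge0// powR_ge0. Qed.

Lemma measurable_sym_kernel :
  measurable_fun [set: measurableTypeR R * measurableTypeR R]%classic
    (fun p => sym_kernel p.1 p.2 : measurableTypeR R).
Proof.
have mp (p : R) : measurable_fun [set: measurableTypeR R]%classic
  (fun x => x `^ p : measurableTypeR R) by exact: measurable_powR.
apply: measurable_funM; last apply: measurable_funD.
- apply: (measurableT_comp _ measurable_fst).
  by apply: measurable_indic; exact: measurable_itv.
- apply: (measurableT_comp (mp _)); apply: measurableT_comp => //.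
  exact: measurable_funB.
- apply: (measurableT_comp (mp _)); apply: measurableT_comp => //.
  exact: measurable_funD.
Qed.

Lemma integral_sym_kernel : exists C : R, forall w : R,
  (\int[@lebesgue_measure R]_x (sym_kernel x w)%:E <= C%:E)%E.
Proof.
have M0 : 0 < M by exact: lt_le_trans M1.
have [C HC] := integral_powR_dist th_itv M0; exists (C + C) => w.
set D : set (measurableTypeR R) := `[- M, M]%classic.
have mD : measurable D by exact: measurable_itv.
have md (u : R) : measurable_fun D (fun x => (`|x - u| `^ (- th))%:E).
  apply/measurable_EFinP; apply: (measurableT_comp (measurable_powR _)).
  by apply: measurableT_comp => //; apply: measurable_funB.
have -> : (\int[@lebesgue_measure R]_x (sym_kernel x w)%:E =
    \int[@lebesgue_measure R]_(x in D) ((`|x - w| `^ (- th))%:E + (`|x - - w| `^ (- th))%:E))%E.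
  rewrite [RHS]integral_mkcond; apply: eq_integral => x _.
  rewrite /sym_kernel patchE indicE opprK; case: ifP => _; last by rewrite mul0r.
  by rewrite mul1r EFinD.
rewrite ge0_integralD//.
by rewrite EFinD leeD.
Qed.

(** Since 2 x = (x - w) + (x + w), the larger of |x - w| and |x + w|, say v, is at least |x|. Then
    |x| v^(-th) <= v^(1 - th) <= (2 M)^(1 - th), and only the power of the other factor remains. *)
Lemma le_sym_kernel (x w : R) : `|x| <= M -> `|w| <= M -> x ^+ 2 != w ^+ 2 ->
  `|x| * `|x ^+ 2 - w ^+ 2| `^ (- th) <= (M *+ 2) `^ (1 - th) * sym_kernel x w.
Proof.
move=> xM wM xw; have /andP[th0 th1] := th_itv.
rewrite /sym_kernel indicE mem_set ?mul1r; last by rewrite /= in_itv/= -ler_norml.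
have M20 : 0 <= M *+ 2 by rewrite mulrn_wge0// (le_trans ler01).
have base (u v : R) : `|x| <= `|v| -> u != 0 -> v != 0 -> `|v| <= M *+ 2 ->
    `|x| * (`|u| * `|v|) `^ (- th) <= (M *+ 2) `^ (1 - th) * `|u| `^ (- th).
  move=> xv u0 v0 vM; rewrite powRM// mulrCA mulrC.
  rewrite ler_wpM2r ?powR_ge0//.
  apply: (@le_trans _ _ (`|v| * `|v| `^ (- th))); first by rewrite ler_wpM2r ?powR_ge0.
  rewrite -{1}(powRr1 (normr_ge0 v)) -powRD ?normr_eq0 ?v0 ?implybT//.
  by apply: ge0_ler_powR; rewrite ?nnegrE ?subr_ge0// ltW.
have xwE : x ^+ 2 - w ^+ 2 = (x - w) * (x + w) by ring.
have : (x - w) * (x + w) != 0 by rewrite -xwE subr_eq0.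
rewrite mulf_eq0 negb_or => /andP[d0 s0].
have sM : `|x - w| <= M *+ 2 by rewrite mulr2n (le_trans (ler_normB _ _))// lerD.
have dM : `|x + w| <= M *+ 2 by rewrite mulr2n (le_trans (ler_normD _ _))// lerD.
have c0 : 0 <= (M *+ 2) `^ (1 - th) by exact: powR_ge0.
rewrite xwE normrM mulrDr.
have [xd|xd] := leP `|x| `|x + w|.
  by apply: ler_wpDr; [rewrite mulr_ge0// powR_ge0|exact: base].
rewrite mulrC [`|x - w| * _]mulrC mulrC.
apply: ler_wpDl; first by rewrite mulr_ge0// powR_ge0.
apply: base => //.
suff : `|x| + `|x| <= `|x + w| + `|x - w| by lra.
rewrite -mulr2n -normrMn (_ : x *+ 2 = (x + w) + (x - w)); last by ring.
exact: ler_normD.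
Qed.
End SymmetricKernel.

(** * The pointwise bound *)

Lemma metric_prod_powR_le {R : realType} {n : nat} (d a : 'I_n.+1 -> 'I_n.+1 -> R)
    (th D : R) :
  (forall i, d i i = 0) -> (forall i j, d i j = d j i) ->
  (forall i j k, d i k <= d i j + d j k) -> (forall i j, i != j -> 0 < d i j) ->
  (forall i j, d i j <= D) -> 0 < D ->
  (forall i, a i i = 0) -> 0 <= th ->
  (forall U : {set 'I_n.+1}, U != finset.set0 -> 0 <= excess a th U) ->
  \prod_i \prod_j d i j `^ a i j <=
  (\prod_i \prod_j n.+1%:R `^ `|a i j|) * D `^ excess a th [set: 'I_n.+1]%SET *
  \prod_(v < n) prev_kernel d th [set: 'I_n.+1]%SET (lift ord0 v).
Proof.
move=> dxx dC dtri dpos dD D0 aii th0 excess0.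
pose nR : R := n.+1%:R.
have nR1 : 1 <= nR by rewrite ler1n.
have nR0 : 0 < nR by rewrite ltr0n.
pose w i j := d i j `^ a i j * nR `^ (- `|a i j|).
have wii i : w i i <= 1 by rewrite /w aii normr0 oppr0 !powRr0 mulr1.
have w0 i j : 0 <= w i j by rewrite mulr_ge0// powR_ge0.
have w_le i j E : i != j -> 0 < E -> E / nR <= d i j <= E -> w i j <= E `^ a i j.
  move=> ij E0 /andP[dE1 dE2]; have dij := dpos _ _ ij.
  rewrite /w; have [a0|a0] := leP 0 (a i j).
    rewrite -[leRHS]mulr1; apply: ler_pM; rewrite ?powR_ge0//.
      by rewrite ge0_ler_powR ?nnegrE// ltW.
    by rewrite -(powRr0 nR) ler_powR// oppr_le0.
  rewrite ltr0_norm// opprK.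
  rewrite -powRM ?(ltW dij) ?(ltW nR0)// -[a i j]opprK !(powRN _ (- a i j)).
  rewrite lef_pV2 ?posrE ?powR_gt0 ?mulr_gt0//.
  rewrite ge0_ler_powR ?nnegrE ?oppr_ge0 ?mulr_ge0 ?(ltW a0) ?(ltW E0) ?(ltW dij) ?(ltW nR0)//.
  by rewrite -ler_pdivrMr.
have := weighted_metric_le dxx dC dtri dpos aii wii w0 w_le th0 excess0
  (finset.in_setT ord0) (fun j _ => leq0n j) (fun i j _ _ => dD i j) D0.
rewrite (eq_bigl xpredT); last by move=> i; rewrite inE.
under eq_bigr do (rewrite (eq_bigl xpredT); last by move=> ?; rewrite inE).
have -> : \prod_(v in [set: 'I_n.+1]%SET :\ ord0) prev_kernel d th [set: 'I_n.+1]%SET v =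
    \prod_(v < n) prev_kernel d th [set: 'I_n.+1]%SET (lift ord0 v).
  rewrite (eq_bigl (fun i => i != ord0)); last by move=> i; rewrite !inE andbT.
  by rewrite big_mkcond big_ord_recl/= mul1r; apply: eq_bigr.
move=> h; rewrite -mulrA; apply: (le_trans _ (ler_wpM2l _ h)).
  rewrite -big_split/=; apply: ler_prod => i _.
  rewrite prodr_ge0/=; last by move=> *; exact: powR_ge0.
  rewrite -big_split/=; apply: ler_prod => j _; rewrite powR_ge0/= /w mulrCA.
  by rewrite -powRD ?subrr ?powRr0 ?mulr1// (gt_eqF nR0) implybT.
by apply: prodr_ge0 => i _; apply: prodr_ge0 => j _; exact: powR_ge0.
Qed.

Lemma prod_ord_recl_pairs {R : comPzRingType} {n : nat} (F : 'I_n.+1 -> 'I_n.+1 -> R) :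
  \prod_i \prod_j F i j = F ord0 ord0 *
    (\prod_i (F ord0 (lift ord0 i) * F (lift ord0 i) ord0)) *
    \prod_i \prod_j F (lift ord0 i) (lift ord0 j).
Proof.
rewrite big_ord_recl big_ord_recl -!mulrA; congr (_ * _).
rewrite [in RHS]big_split/= -mulrA; congr (_ * _).
by rewrite -big_split/=; apply: eq_bigr => i _; rewrite big_ord_recl.
Qed.

Section Colouring.
Context {R : realType} {N K s : nat}.
Variables (col : 'I_N -> 'I_K) (t : 'I_K -> bool) (M : R).
Hypotheses (ts : (s = \sum_(c < K) ~~ t c)%N) (KN : (K < N)%N) (M1 : 1 <= M).
Let r : R := K.+1%:R.
Let th : R := @decay R N K.

(** [colour_num] and [sqr_den] are the squares of a generator and of the denominator, written over
    ordered pairs to match the double sums in [excess]. *)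
Definition colour_num (x : 'rV[R]_N) : R :=
  (\prod_i \prod_(j | (j != i) && (col j == col i)) `|x 0 i ^+ 2 - x 0 j ^+ 2|) *
  \prod_(i | t (col i)) x 0 i ^+ 2.

Definition sqr_den (x : 'rV[R]_N) : R :=
  (\prod_i \prod_(j | j != i) `|x 0 i ^+ 2 - x 0 j ^+ 2| `^ (1 / r)) *
  \prod_i `|x 0 i| `^ (1 - 2 * s%:R / r).

Lemma colour_num_le : exists2 A : R, 0 <= A & forall x : 'rV[R]_N,
  (forall i, `|x 0 i| <= M) -> (forall i, x 0 i != 0) ->
  (forall i j, i != j -> x 0 i ^+ 2 != x 0 j ^+ 2) ->
  colour_num x <= A * chain (sym_kernel th M) [:: 0] x * sqr_den x.
Proof.
have M0 : 0 < M by exact: lt_le_trans M1.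
have th_itv : 0 <= th < 1 by exact: decay_itv.
have /andP[th0 th1] := th_itv.
pose a := rooted (root_expo s col t) (pair_expo col) : 'I_N.+1 -> 'I_N.+1 -> R.
pose A1 := (\prod_i \prod_j N.+1%:R `^ `|a i j|) *
  (M ^+ 2) `^ excess a th [set: 'I_N.+1]%SET.
have A10 : 0 <= A1.
  apply: mulr_ge0; last exact: powR_ge0.
  by apply: prodr_ge0 => i _; apply: prodr_ge0 => j _; exact: powR_ge0.
pose c := (M *+ 2) `^ (1 - th).
have c0 : 0 <= c by exact: powR_ge0.
exists (A1 * c ^+ N) => [|x xM x0 xx]; first by rewrite mulr_ge0// exprn_ge0.
pose Y (i : 'I_N.+1) : R := if unlift ord0 i is Some k then x 0 k ^+ 2 else 0.
have Y0 : Y ord0 = 0 by rewrite /Y unlift_none.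
have YS i : Y (lift ord0 i) = x 0 i ^+ 2 by rewrite /Y liftK.
pose d i j := `|Y i - Y j|.
have YM i : 0 <= Y i <= M ^+ 2.
  case: (unliftP ord0 i) => [k|] ->; rewrite ?Y0 ?YS.
    by rewrite sqr_ge0/= -[x 0 k ^+ 2]real_normK ?num_real// lerXn2r ?nnegrE// ltW.
  by rewrite lexx exprn_ge0// ltW.
have dpos i j : i != j -> 0 < d i j.
  rewrite /d normr_gt0 subr_eq0; apply: contraNN.
  case: (unliftP ord0 i) => [i'|] ->; case: (unliftP ord0 j) => [j'|] ->; rewrite ?Y0 ?YS //.
  - by apply: contraTT => ij; apply: xx; apply: contraNN ij => /eqP ->.
  - by rewrite sqrf_eq0 (negbTE (x0 _)).
  - by rewrite eq_sym sqrf_eq0 (negbTE (x0 _)).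
have dM i j : d i j <= M ^+ 2.
  have /andP[] := YM i; have /andP[] := YM j; rewrite /d ler_norml; lra.
have aii i : a i i = 0.
  case: (unliftP ord0 i) => [i'|] ->; rewrite /a ?rooted_rw//.
  by rewrite /pair_expo eqxx.
have P_le : \prod_i \prod_j d i j `^ a i j <=
    A1 * \prod_(v < N) prev_kernel d th [set: 'I_N.+1]%SET (lift ord0 v).
  apply: metric_prod_powR_le => //.
  - by move=> i; rewrite /d subrr normr0.
  - by move=> i j; rewrite /d distrC.
  - by move=> i j k; rewrite /d -(subrKA (Y j)) ler_normD.
  - by rewrite exprn_gt0.
  - by move=> U; exact: excess_rooted_ge0.
have numE : colour_num x =
    (\prod_i \prod_j d i j `^ a i j) * (\prod_i `|x 0 i|) * sqr_den x.
  rewrite prod_ord_recl_pairs aii powRr0 mul1r /colour_num /sqr_den.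
  have -> : forall u v w p q : R, u * v * w * (p * q) = (v * p) * (u * w * q).
    by move=> *; ring.
  congr (_ * _).
    rewrite -big_split/=; apply: eq_bigr => i _.
    rewrite big_mkcond [X in _ * X]big_mkcond -big_split/=; apply: eq_bigr => j _.
    rewrite /d !YS /a rooted_rw /pair_expo eq_sym.
    have [->|ij] := eqVneq i j; first by rewrite powRr0 mulr1.
    have dij : `|x 0 i ^+ 2 - x 0 j ^+ 2| != 0 by rewrite normr_eq0 subr_eq0 xx.
    rewrite -powRD ?dij ?implybT// eq_sym div1r subrK.
    by case: eqP => _; rewrite ?powRr1 ?powRr0.
  rewrite big_mkcond -!big_split/=; apply: eq_bigr => i _.
  rewrite /d Y0 !YS /a !rooted_rw sub0r normrN subr0 normrX.
  have xi : `|x 0 i| != 0 by rewrite normr_eq0.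
  rewrite -[`|x 0 i| ^+ 2]powR_mulrn// -!powRrM -[X in _ * X * _](powRr1 (normr_ge0 _)).
  rewrite -!powRD ?xi ?implybT// /root_expo.
  (* 2 t = 4 [root_expo] + 1 + (1 - 2 s / r): the factor 4 comes from the two orders of the pair and
     from y = x^2, the 1 from the extracted |x_i|. *)
  rewrite [X in _ `^ X](_ : _ = 2 * (t (col i))%:R); last first.
    by rewrite -/r; field; rewrite gt_eqF// ltr0n.
  case: (t (col i)); last by rewrite mulr0 powRr0.
  by rewrite mulr1 powR_mulrn// real_normK// num_real.
(* Each kernel receives one factor |x_i|. Its term at [ord0] matches the entry 0 of the list
   [[:: 0]], the other terms match the earlier coordinates. *)
have kerE : (\prod_i `|x 0 i|) * \prod_(v < N) prev_kernel d th [set: 'I_N.+1]%SET (lift ord0 v)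
    <= c ^+ N * chain (sym_kernel th M) [:: 0] x.
  rewrite -[X in c ^+ X]card_ord -prodr_const /chain -!big_split/=.
  apply: ler_prod => i _; rewrite mulr_ge0 ?prev_kernel_ge0//=.
  rewrite /prev_kernel (eq_bigl (fun u : 'I_N.+1 => (u < lift ord0 i)%N)); last first.
    by move=> u; rewrite inE.
  rewrite big_mkcond big_ord_recl/= -big_mkcond/= big_cons big_nil addr0.
  rewrite !mulrDr; apply: lerD.
    have := le_sym_kernel th_itv M1 (xM i) (_ : `|0| <= M); rewrite expr0n/= normr0 (ltW M0).
    by rewrite /d Y0 YS; apply => //; rewrite sqrf_eq0.
  rewrite !mulr_sumr; apply: ler_sum => j ji; rewrite /d !YS.
  apply: (le_sym_kernel th_itv M1) => //; apply: xx.
  by apply: contraTneq ji => ->; rewrite ltnn.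
have den0 : 0 <= sqr_den x.
  apply: mulr_ge0; apply: prodr_ge0 => i _; last exact: powR_ge0.
  by apply: prodr_ge0 => j _; exact: powR_ge0.
rewrite numE ler_wpM2r// -[X in _ <= X]mulrA.
rewrite mulrC; apply: (le_trans (ler_wpM2l _ P_le)); first exact: prodr_ge0.
by rewrite mulrCA ler_wpM2l.
Qed.
End Colouring.

(** * Null sets and measurability *)

Section ComplexPolynomials.
Context {R : realType} {N : nat}.
Local Notation normc := ComplexField.Normc.normc.

Lemma normc_real (a : R) : normc a%:C = `|a|.
Proof. by rewrite /normc/= expr0n addr0 sqrtr_sqr. Qed.

Lemma normc_ge0 (z : R[i]) : 0 <= normc z.
Proof. by case: z => a b; exact: sqrtr_ge0. Qed.

Lemma ler_normc_sum (I : Type) (s : seq I) (F : I -> R[i]) :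
  normc (\sum_(i <- s) F i) <= \sum_(i <- s) normc (F i).
Proof.
elim/big_rec2 : _ => [|i y x _ xy]; first by rewrite ComplexField.Normc.normc0.
by apply: le_trans (le_normcD _ _) _; rewrite lerD2l.
Qed.

Lemma normc_sqr (z : R[i]) : normc z ^+ 2 = complex.Re z ^+ 2 + complex.Im z ^+ 2.
Proof. by case: z => a b; rewrite /normc sqr_sqrtr// addr_ge0// sqr_ge0. Qed.

Lemma meval_realE (p : {mpoly R[i][N]}) (x : 'I_N -> R) :
  p.@[fun i => (x i)%:C] =
  \sum_(m <- msupp p) p@_m * (\prod_i x i ^+ m i)%:C.
Proof.
rewrite mevalE; apply: eq_bigr => m _; congr (_ * _).
by rewrite rmorph_prod; apply: eq_bigr => i _; rewrite rmorphXn.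
Qed.

Lemma meval_bounded (p : {mpoly R[i][N]}) (M : R) : exists2 B : R, 0 <= B &
  forall x : 'I_N -> R, (forall i, `|x i| <= M) -> normc p.@[fun i => (x i)%:C] <= B.
Proof.
exists (\sum_(m <- msupp p) normc p@_m * \prod_(i < N) `|M| ^+ m i) => [|x xM].
  apply: sumr_ge0 => m _; rewrite mulr_ge0 ?normc_ge0//.
  by apply: prodr_ge0 => i _; rewrite exprn_ge0.
rewrite meval_realE; apply: le_trans (ler_normc_sum _ _) _; apply: ler_sum => m _.
rewrite ComplexField.Normc.normcM normc_real ler_wpM2l ?normc_ge0// normr_prod.
apply: ler_prod => i _; rewrite normr_ge0/= normrX lerXn2r ?nnegrE//.
exact: le_trans (xM i) (ler_norm _).
Qed.

Lemma measurable_normc_meval (p : {mpoly R[i][N]}) :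
  measurable_fun [set: 'rV[R]_N]%classic
    (fun x => normc p.@[fun i => (x 0 i)%:C] ^+ 2 : measurableTypeR R).
Proof.
have mmon (c : 'X_{1..N} -> R) : measurable_fun [set: 'rV[R]_N]%classic
    (fun x => \sum_(m <- msupp p) c m * \prod_i x 0 i ^+ m i : measurableTypeR R).
  apply: measurable_sum => m; apply: measurable_funM => //.
  apply: measurable_prod => i _; apply: measurable_funX.
  exact: measurable_coord.
have -> : (fun x : 'rV[R]_N => normc p.@[fun i => (x 0 i)%:C] ^+ 2) =
    (fun x => (\sum_(m <- msupp p) complex.Re p@_m * \prod_i x 0 i ^+ m i) ^+ 2 +
              (\sum_(m <- msupp p) complex.Im p@_m * \prod_i x 0 i ^+ m i) ^+ 2).
  apply/funext => x; rewrite normc_sqr meval_realE; congr (_ ^+ 2 + _ ^+ 2).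
    elim/big_rec2 : _ => // m y z _ <-.
    by case: (p@_m) => a b; case: z => u v /=; ring.
  elim/big_rec2 : _ => // m y z _ <-.
  by case: (p@_m) => a b; case: z => u v /=; ring.
by apply: measurable_funD; apply: measurable_funX; exact: mmon.
Qed.
End ComplexPolynomials.

Definition cube {R : realType} {n : nat} (M : R) : set 'rV[R]_n :=
  [set x | forall i, `|x 0 i| <= M]%classic.

Lemma measurable_cube {R : realType} {n : nat} (M : R) :
  measurable (cube M : set 'rV[R]_n).
Proof.
rewrite (_ : cube M = \bigcap_(i in setT) (@Defs.coord R n i @^-1` `[- M, M]))%classic.
  apply: fin_bigcap_measurable; first exact: finite_finset.
  move=> i _; rewrite -[X in measurable X]setTI; exact: measurable_coord.
apply/seteqP; split=> x xM i; first by move=> _; rewrite /= in_itv/= -ler_norml; exact: xM.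
by have := xM i I; rewrite /= in_itv/= -ler_norml.
Qed.

Lemma nbhs_cube {R : realType} {n : nat} (x : 'rV[R]_n) :
  exists2 M : R, 1 <= M & nbhs x (cube M).
Proof.
exists (1 + \sum_i `|x 0 i|); first by rewrite lerDl sumr_ge0.
apply/nbhs_ballP; exists 1 => //= y xy i.
have xyi : `|x 0 i - y 0 i| < 1 by have [_ /(_ 0 i)] := xy.
have xi : `|x 0 i| <= \sum_i `|x 0 i| by rewrite (bigD1 i)//= lerDl sumr_ge0.
rewrite -[y 0 i](subKr (x 0 i)); apply: le_trans (ler_normB _ _) _.
by rewrite addrC lerD// ltW.
Qed.

Lemma measurable_den {R : realType} {N : nat} (p q : R) :
  measurable_fun [set: 'rV[R]_N]%classic (fun x : 'rV[R]_N =>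
    (\prod_(i < N) \prod_(j < N | (i < j)%N) `|x 0 i ^+ 2 - x 0 j ^+ 2| `^ p) *
    \prod_(i < N) `|x 0 i| `^ q : measurableTypeR R).
Proof.
have mp (e : R) : measurable_fun [set: measurableTypeR R]%classic
  (fun a => a `^ e : measurableTypeR R) by exact: measurable_powR.
have mc i : measurable_fun [set: 'rV[R]_N]%classic (fun x => x 0 i : measurableTypeR R).
  exact: measurable_coord.
apply: measurable_funM; apply: measurable_prod => i _.
  under eq_fun do rewrite -big_filter.
  apply: measurable_prod => j _; apply: (measurableT_comp (mp _)).
  by apply: measurableT_comp => //; apply: measurable_funB;
    apply: measurable_funX; exact: mc.
apply: (measurableT_comp (mp _)); apply: measurableT_comp => //; exact: mc.
Qed.

Lemma negligible_coord0 {R : realType} {n : nat} :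
  (lebesgue_rV n).-negligible [set x : 'rV[R]_n | exists i, x 0 i = 0]%classic.
Proof.
pose Z i : set 'rV[R]_n := [set x | x 0 i = 0]%classic.
have ZE : ([set x : 'rV[R]_n | exists i, x 0 i = 0] `<=` \big[setU/set0]_(i < n) Z i)%classic.
  move=> x [i xi]; rewrite -bigcup_seq/=; exists i; last exact: xi.
  by rewrite /= mem_index_enum.
apply: negligibleS ZE _; elim/big_ind : _ => [||i _].
- exact: negligible_set0.
- by move=> *; exact: negligibleU.
have mZ : measurable (Z i).
  rewrite (_ : Z i = @Defs.coord R n i @^-1` [set 0])%classic//.
  by rewrite -[X in measurable X]setTI; apply: measurable_coord => //; exact: measurable_set1.
apply/negligibleP => //.
pose A j : set (measurableTypeR R) := if j == i then [set 0]%classic else setT.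
have -> : Z i = [set x | forall j, A j (x 0 j)]%classic.
  apply/seteqP; split => x /=; rewrite /Z/= /A => xi.
    by move=> j; case: eqP => // ->.
  by have := xi i; rewrite eqxx.
have mA j : measurable (A j) by rewrite /A; case: ifP => // _; exact: measurable_set1.
apply: etrans (lebesgue_rV_box mA) _.
by rewrite (bigD1 i)//= /A eqxx lebesgue_measure_set1 mul0e.
Qed.

(** * From a single generator to the whole ideal, and conclusion *)

Section GeneratorEstimate.
Context {R : realType}.
Variables (N K s : nat) (M : R).
Hypotheses (K0 : (0 < K)%N) (KN : (K < N)%N) (sK : (s <= K)%N) (M1 : 1 <= M).
Let T := T_last K (K - s).
Let r : R := K.+1%:R.
Local Notation normc := ComplexField.Normc.normc.

Definition den (x : 'rV[R]_N) : R :=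
  (\prod_(i < N) \prod_(j < N | (i < j)%N) `|x 0 i ^+ 2 - x 0 j ^+ 2| `^ (1 / r)) *
  (\prod_(i < N) `|x 0 i| `^ (1 / 2 - s%:R / r)).

Definition majorant (x : 'rV[R]_N) : R :=
  chain (sym_kernel (@decay R N K) M) [:: 0] x.

Lemma den_ge0 x : 0 <= den x.
Proof.
apply: mulr_ge0; apply: prodr_ge0 => i _; last exact: powR_ge0.
by apply: prodr_ge0 => j _; exact: powR_ge0.
Qed.

Lemma den_sqr x : den x ^+ 2 = @sqr_den R N K s x.
Proof.
rewrite exprMn sqr_prod_lt_pairs => [|i j]; last by rewrite distrC.
congr (_ * _); rewrite -prodrXl; apply: eq_bigr => i _.
rewrite -powR_mulrn ?powR_ge0// -powRrM; congr (_ `^ _).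
by rewrite -/r; field; rewrite gt_eqF// ltr0n.
Qed.

Lemma generator_le (sg : 'S_N) : exists2 A : R, 0 <= A & forall x : 'rV[R]_N,
  cube M x -> (forall i, x 0 i != 0) -> den x != 0 ->
  normc (msym sg (p_part_set (nu_part N K) T [seq 'X_i | i <- enum 'I_N])).@[
    fun i => (x 0 i)%:C] ^+ 2 <= A * majorant x * den x ^+ 2.
Proof.
have [col colE] := @p_part_set_colouring R N K T sg K0.
have ts : (s = \sum_(c < K) ~~ (c \in T))%N.
  rewrite -[LHS]card_ord -sum1_card (big_ord_widen _ (fun=> 1%N) sK) big_mkcond/=.
  by apply: eq_bigr => c _; rewrite inE subKn// -ltnNge; case: ltnP.
have [A A0 HA] := colour_num_le col ts KN M1; exists A => // x xM x0 dx.
rewrite msym_p_part_set normc_real real_normK ?num_real// den_sqr.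
rewrite (colE (fun i => x 0 i)); apply: HA => // i j ij.
(* A nonzero denominator separates the squares, since 0^(1/r) = 0. It does not give x_i <> 0,
   because |x_i|^0 = 1 when 2 s = r. *)
have zero (i' j' : 'I_N) : (i' < j')%N -> x 0 i' ^+ 2 = x 0 j' ^+ 2 -> den x = 0.
  move=> ij' xij; rewrite /den (bigD1 i')//= (bigD1 j')//= xij subrr normr0.
  by rewrite powR0 ?mul0r// div1r invr_eq0 pnatr_eq0.
apply: contraNneq dx => xij; apply/eqP.
move: ij; rewrite neq_ltn => /orP[ij|ji]; first exact: zero xij.
exact: zero ji (esym xij).
Qed.
End GeneratorEstimate.

Section IdealEstimate.
Context {R : realType}.
Variables (N K s : nat) (M : R).
Hypotheses (K0 : (0 < K)%N) (KN : (K < N)%N) (sK : (s <= K)%N) (M1 : 1 <= M).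
Local Notation normc := ComplexField.Normc.normc.
Local Notation den := (@den R N K s).
Local Notation majorant := (majorant K M : 'rV[R]_N -> R).

Lemma majorant_ge0 (x : 'rV[R]_N) : 0 <= majorant x.
Proof. by apply: chain_ge0 => *; exact: sym_kernel_ge0. Qed.

(** The squared bounds for the generators are turned into bounds by the square root of the majorant,
    where the triangle inequality applies, and the sum is squared again. The polynomial coefficients
    are bounded on the cube. *)
Lemma ideal_le (f : {mpoly R[i][N]}) : K_ideal R N K (K - s) f ->
  exists2 B : R, 0 <= B & forall x : 'rV[R]_N, cube M x -> (forall i, x 0 i != 0) ->
    normc (f.@[fun i => (x 0 i)%:C] / (den x)%:C) ^+ 2 <= B * majorant x.
Proof.
move=> [m [c [g [gK ->]]]].
have /fin_all_exists2[B B0 HB] (k : 'I_m) : exists2 B : R, 0 <= B &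
    forall x : 'rV[R]_N, cube M x -> (forall i, x 0 i != 0) -> den x != 0 ->
    normc (c k * g k).@[fun i => (x 0 i)%:C] <= B * (Num.sqrt (majorant x) * den x).
  have [sg _ <-] := gK k.
  have [A A0 HA] := generator_le K0 KN sK M1 sg.
  have [C C0 HC] := meval_bounded (c k) M.
  exists (C * Num.sqrt A) => [|x xM x0 dx]; first by rewrite mulr_ge0// sqrtr_ge0.
  rewrite mevalM ComplexField.Normc.normcM -mulrA.
  apply: ler_pM; rewrite ?normc_ge0 ?HC//.
  rewrite -[den x]ger0_norm ?den_ge0// -sqrtr_sqr -!sqrtrM ?majorant_ge0//.
  rewrite -[leLHS]ger0_norm ?normc_ge0// -sqrtr_sqr ler_wsqrtr//.
  by rewrite mulrA; exact: HA.
exists ((\sum_k B k) ^+ 2) => [|x xM x0]; first by rewrite sqr_ge0.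
have [d0|dx] := eqVneq (den x) 0.
  rewrite d0 invr0 mulr0 ComplexField.Normc.normc0 expr0n/=.
  by rewrite mulr_ge0 ?sqr_ge0// majorant_ge0.
have dgt0 : 0 < den x by rewrite lt0r dx den_ge0.
rewrite ComplexField.Normc.normcM ComplexField.Normc.normcV normc_real gtr0_norm//.
rewrite -[majorant x]sqr_sqrtr ?majorant_ge0// -exprMn lerXn2r ?nnegrE//.
- by rewrite mulr_ge0 ?normc_ge0// invr_ge0 ltW.
- by rewrite mulr_ge0 ?sqrtr_ge0// sumr_ge0.
rewrite ler_pdivrMr// -mulrA mulr_suml rmorph_sum.
by apply: le_trans (ler_normc_sum _ _) _; apply: ler_sum => k _; exact: HB.
Qed.

Lemma measurable_majorant : measurable_fun [set: 'rV[R]_N]%classic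
  (fun x => majorant x : measurableTypeR R).
Proof. by apply: measurable_chain; exact: measurable_sym_kernel. Qed.

Lemma majorant_integrable : (\int[lebesgue_rV N]_x (majorant x)%:E < +oo)%E.
Proof.
have th_itv : 0 <= @decay R N K < 1 by exact: decay_itv.
have [C HC] := integral_sym_kernel th_itv M1.
have [B _ HB] := integral_chain_fin (@sym_kernel_ge0 R _ M)
  (measurable_sym_kernel _ M) HC N 1.
by apply: le_lt_trans (HB [:: 0] erefl) _; rewrite ltry.
Qed.
End IdealEstimate.

(* At the zeros of the denominator, a Lebesgue-null set, the quotient is 0 by
   the convention 0^-1 = 0. *)
Theorem theorem5p11 (R : realType) (N r s : nat)
    (hr : (2 <= r <= N)%N) (hs : (s <= r - 1)%N)
    (f : {mpoly R[i][N]}) (hf : K_ideal R N (r - 1) (r - s - 1) f) :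
  locally_L2 (fun x : 'rV[R]_N =>
    f.@[fun i => (x 0 i)%:C] /
    ((\prod_(i < N) \prod_(j < N | (i < j)%N)
        `|x 0 i ^+ 2 - x 0 j ^+ 2| `^ (1 / r%:R)) *
     (\prod_(i < N) `|x 0 i| `^ (1 / 2 - s%:R / r%:R)))%:C).
Proof.
case: r => [|K] in hr hs hf *; first by case/andP: hr.
have /andP[K0 KN] : (0 < K < N)%N by exact: hr.
move: hs hf; rewrite subn1 /= (_ : (K.+1 - s - 1)%N = (K - s)%N); last by lia.
move=> sK fK x0; have [M M1 nM] := nbhs_cube x0.
have [B B0 HB] := ideal_le K0 KN sK M1 fK.
exists (cube M); split => //; first exact: measurable_cube.
have mU := @measurable_cube R N M.
set F := fun y : 'rV[R]_N => (_ ^+ 2)%:E.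
have F0 y : (0 <= F y)%E by rewrite lee_fin sqr_ge0.
have mF : measurable_fun (cube M) F.
  apply: measurable_funTS; apply/measurable_EFinP.
  (* The inverse square becomes a real power, whose measurability is known; at a = 0 both sides are
     0 by convention. *)
  have normE (z : R[i]) (a : R) : 0 <= a ->
      ComplexField.Normc.normc (z / a%:C) ^+ 2 =
      ComplexField.Normc.normc z ^+ 2 * a `^ (- 2%:R).
    move=> a0; rewrite ComplexField.Normc.normcM ComplexField.Normc.normcV normc_real.
    by rewrite ger0_norm// powR_invn// exprMn exprVn.
  under eq_fun do rewrite normE ?(@den_ge0 R N K s)//.
  apply: measurable_funM; first exact: measurable_normc_meval.
  exact: (measurableT_comp (measurable_powR _) (measurable_den _ _)).
apply/integrableP; split => //.
under eq_integral do rewrite gee0_abs//.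
have mMaj : measurable_fun [set: 'rV[R]_N]%classic (fun y => (B * majorant K M y)%:E).
  by apply/measurable_EFinP; apply: measurable_funM => //; exact: measurable_majorant.
apply: (@le_lt_trans _ _ (\int[lebesgue_rV N]_(y in cube M) (B * majorant K M y)%:E)%E).
  apply: ae_ge0_le_integral => //.
  - by move=> y _; rewrite lee_fin mulr_ge0// majorant_ge0.
  - exact: measurable_funTS.
  (* When 2 s = r the denominator does not vanish on x_i = 0, where the bound may
     fail. *)
  have [Z [mZ Z0 subZ]] := @negligible_coord0 R N.
  exists Z; split => // y /= /not_implyP[yM yF]; apply: subZ.
  apply: contrapT => /forallNP yi; apply: yF; rewrite lee_fin.
  by apply: HB => // i; apply/eqP; exact: yi.
apply: (@le_lt_trans _ _ (\int[lebesgue_rV N]_y (B * majorant K M y)%:E)%E).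
  by apply: ge0_subset_integral => // y _; rewrite lee_fin mulr_ge0// majorant_ge0.
under eq_integral do rewrite EFinM.
rewrite ge0_integralZl_EFin//; last 2 first.
- by move=> y _; rewrite lee_fin majorant_ge0.
- by apply/measurable_EFinP; exact: measurable_majorant.
by rewrite lte_mul_pinfty// majorant_integrable.
Qed.
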